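(* Every finite loopless signed multigraph $\Sigma=(G,\sigma)$ satisfies $$\chi'(\Sigma)\leq\Delta(G)+\mu(G).$$
   Context: All graphs are finite and loopless; parallel edges are allowed. $\Delta(G)$ is the maximum degree of $G$ and, for distinct vertices $u,v$, $\mu_G(u,v)$ is the number of edges of $G$ joining $u$ and $v$; $\mu(G)=\max\{\mu_G(u,v):u,v\in V(G),\ u\neq v\}$ (a maximum over an empty set is $0$). A signed multigraph $\Sigma=(G,\sigma)$ consists of a multigraph $G$ and a signature $\sigma:E(G)\to\{1,-1\}$. Each edge $e=uv$ consists of two half-edges: $h_e^u$ at $u$ and $h_e^v$ at $v$. $H(G)$ is the set of all half-edges of $G$, and $H_G(v)$ the set of half-edges at the vertex $v$. For a nonnegative integer $k$, let $M_k=\{-r,\dots,-1\}\cup\{1,\dots,r\}$ if $k=2r$, and $M_k=\{-r,\dots,r\}$ (including $0$) if $k=2r+1$. A $k$-edge-coloring of $\Sigma$ is a mapping $\gamma:H(G)\to M_k$ such that the colors of the half-edges in $H_G(v)$ are pairwise distinct for every $v\in V(G)$, and $\gamma(h_e^u)=-\sigma(e)\gamma(h_e^v)$ for every edge $e=uv\in E(G)$. The chromatic index $\chi'(\Sigma)$ is the least nonnegative integer $k$ for which $\Sigma$ has a $k$-edge-coloring. *)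

(* Defs.v *)
From mathcomp Require Import all_boot all_order all_algebra.
From mathcomp Require Import boolp.

Set Implicit Arguments.
Unset Strict Implicit.
Unset Printing Implicit Defensive.

Import GRing.Theory.
Local Open Scope ring_scope.

(* Looplessness is the requirement that every edge has exactly two ends;
   distinct edges may have the same ends. *)
Record multigraph := Multigraph {
  vertex : finType;
  edge : finType;
  ends : edge -> {set vertex};
  card_ends : forall e : edge, #|ends e| = 2%N
}.

Definition degree (G : multigraph) (v : vertex G) : nat :=
  #|[set e : edge G | v \in ends e]|.

Definition max_degree (G : multigraph) : nat :=
  (\max_(v : vertex G) degree v)%N.

Definition multiplicity (G : multigraph) (u v : vertex G) : nat :=
  #|[set e : edge G | ends e == [set u; v]]|.

Definition max_multiplicity (G : multigraph) : nat :=
  (\max_(p : vertex G * vertex G | p.1 != p.2) multiplicity p.1 p.2)%N.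

Record signed_multigraph := SignedMultigraph {
  graph : multigraph;
  signature : edge graph -> int;
  signatureP : forall e : edge graph, signature e = 1 \/ signature e = -1
}.

(* As an edge has two distinct ends, the half-edge h_e^v is encoded by the
   pair (e, v). *)
Definition half_edge (G : multigraph) :=
  {h : edge G * vertex G | h.2 \in ends h.1}.

Definition edge_of (G : multigraph) (h : half_edge G) : edge G := (val h).1.

Definition end_of (G : multigraph) (h : half_edge G) : vertex G := (val h).2.

Definition half_edges_at (G : multigraph) (v : vertex G) : {set half_edge G} :=
  [set h | end_of h == v].

(* M_k: with r = k./2 the colors are -r, ..., r, where 0 is a color only if k is
   odd. *)
Definition palette (k : nat) : pred int :=
  [pred c : int | (`|c| <= k./2)%N && (odd k || (c != 0))].

Definition edge_coloring (S : signed_multigraph) (k : nat)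
    (gamma : half_edge (graph S) -> int) : Prop :=
  [/\ forall h, gamma h \in palette k,
      forall v, {in half_edges_at v &, injective gamma}
    & forall h h', edge_of h = edge_of h' -> end_of h <> end_of h' ->
        gamma h = - signature (edge_of h) * gamma h'].

Definition edge_colorable (S : signed_multigraph) (k : nat) : Prop :=
  exists gamma : half_edge (graph S) -> int, edge_coloring k gamma.

(* Giving the i-th edge the colors i+1 or -(i+1) shows that some k works. *)
Lemma edge_colorable_exists (S : signed_multigraph) :
  exists k, `[< edge_colorable S k >].
Proof.
pose n := #|edge (graph S)|.
pose c (e : edge (graph S)) : int := (enum_rank e).+1%:Z.
pose s (h : half_edge (graph S)) : bool :=
  [pick v in ends (edge_of h)] == Some (end_of h).
pose g h : int := if s h then c (edge_of h)
                  else - signature (edge_of h) * c (edge_of h).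
have sg e : `|- signature e|%N = 1%N.
  by case: (signatureP e) => ->.
have gE h : `|g h|%N = (enum_rank (edge_of h)).+1.
  by rewrite /g; case: (s h); rewrite ?abszM ?sg ?mul1n.
exists n.*2; apply/asboolP; exists g; split.
- move=> h; rewrite inE doubleK odd_double /= gE ltn_ord /=.
  by rewrite -absz_eq0 gE.
- move=> v h h'; rewrite !inE => /eqP hv /eqP hv' gg.
  have /succn_inj/ord_inj/enum_rank_inj ee :
    (enum_rank (edge_of h)).+1 = (enum_rank (edge_of h')).+1.
    by rewrite -!gE gg.
  apply: val_inj; rewrite [val h]surjective_pairing [val h']surjective_pairing.
  by congr pair; [exact: ee | rewrite -/(end_of h) hv -hv'].
- move=> h h' ee nv; rewrite /g /s -ee.
  have mh : end_of h \in ends (edge_of h) by exact: (valP h).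
  have mh' : end_of h' \in ends (edge_of h) by rewrite ee; exact: (valP h').
  have ss : - signature (edge_of h) * - signature (edge_of h) = 1.
    by case: (signatureP (edge_of h)) => ->.
  case: pickP => [w wE|/(_ (end_of h))]; last by rewrite mh.
  have endsE : ends (edge_of h) = [set end_of h; end_of h'].
    apply/esym/eqP; rewrite eqEcard card_ends cards2.
    have /eqP/negPf -> := nv; rewrite andbT.
    by apply/subsetP=> x; rewrite !inE => /orP[] /eqP ->.
  move: wE; rewrite /= endsE !inE => /orP[] /eqP ->.
  + have /eqP/negPf nv1 := nv.
    rewrite eqxx /= ; case: eqP => [[]//|_].
    by rewrite mulrA ss mul1r.
  + rewrite eqxx; case: eqP => [[] /esym //|_]; by [].
Qed.

Definition chromatic_index (S : signed_multigraph) : nat :=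
  ex_minn (edge_colorable_exists S).

(* Main.v *)
(** Giving a maximal matching the colour 0 if [Delta + mu] is odd, it remains to
    colour a graph with an even number of colours, that is, with pairs [c, -c],
    where the vertices not satisfying [degree + mu <= #colours] are independent.
    The vertices are added one by one. When [v] is added, each new edge gets two
    private colours missing at its other end; so the new edges become the edges
    of a multigraph on the set of colours, and they can be coloured if each of
    them can be oriented towards its own colour, that is, if no set [S] of
    colours spans more than [#|S|] edges.

    A Kempe change for the pairs [a, b] and [-a, -b] moves at most two edge-ends
    of this multigraph. If the first edge-end moves from [b] in a minimal
    overfull set (a theta graph or two cycles that share at most a path) to a
    colour [a] outside of all overfull sets, then the change helps unless the
    other edge-end must stay at [-a] or [-b]. The latter cannot be the case for
    the three edge-ends at a branch vertex [b], except if two of them lie on a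
    cycle through [-a] or [-b]; these cases are excluded by other changes, in
    the worst one by joining the two cycles at a common vertex. *)
Require Import Defs.
From mathcomp Require Import all_boot all_order all_algebra.
From mathcomp Require Import zify.
From mathcomp Require boolp.

Set Implicit Arguments.
Unset Strict Implicit.
Unset Printing Implicit Defensive.

Import Order.TTheory GRing.Theory Num.Theory.
Local Open Scope ring_scope.

(** * Excess of a set of labels *)

(** A label is a colour read at [v]: a colour missing at the far end of a new edge is carried to [v]
    through the sign, so the colours of all new edges are compared at one vertex. If [m] new edges
    join [v] to [u], their private colours take [2 * m] colours at [u], while the final degree of
    [u] counts these edges only once; the multiplicity in the bound pays for the difference. Lists
    are given to one edge at a time, and a further edge raises the excess of a set by at most one,
    so only an excess of 1 ever has to be removed. The obstacle is the sign: a positive edge negates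
    the colour along a Kempe chain, so a change of [a] and [b] also exchanges [-a] and [-b], and the
    chain may end at another new edge, whose label then moves too. What makes overfull sets
    tractable is that the excess is supermodular: while it is at most 1, they are closed under union
    and intersection. Hence there is a least one, the core, and, since [v] has at most as many edges
    as there are colours, some colour lies in none of them. *)

Section Excess.

Variables (E C : finType) (X : {set E}).
Implicit Types (L : E * bool -> C) (S T D : {set C}) (e : E) (h g : E * bool).

Definition inside L S e := (L (e, false) \in S) && (L (e, true) \in S).

(** For a set inducing a connected subgraph of the label multigraph this is the cyclomatic number
    minus one: -1 for a tree, 0 for one cycle, 1 for a theta graph or two joined cycles. *)
Definition excess L S : int :=
  (\sum_(e in X) inside L S e)%N%:Z - #|S|%:Z.

Lemma excessE L S :
  excess L S = (\sum_(e in X) inside L S e)%N%:Z - #|S|%:Z.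
Proof. by []. Qed.

Definition opp_half h := (h.1, ~~ h.2).

Definition star L b S : {set E * bool} :=
  [set h | [&& h.1 \in X, L h == b & inside L S h.1]].

Lemma insideE L S h : inside L S h.1 = (L h \in S) && (L (opp_half h) \in S).
Proof. by case: h => e [] //=; rewrite /inside andbC. Qed.

Lemma insideI L S T e : inside L (S :&: T) e = inside L S e && inside L T e.
Proof. by rewrite /inside !inE; do ![case: (_ \in _)]. Qed.

(** The extra sum counts the edges between [S :\: T] and [T :\: S], which lie only in the union. *)
Lemma excess_supermod L S T :
  excess L S + excess L T +
    (\sum_(e in X) [&& inside L (S :|: T) e, ~~ inside L S e & ~~ inside L T e])%N%:Z
  = excess L (S :|: T) + excess L (S :&: T).
Proof.
have cST := cardsUI S T.
have : (\sum_(e in X) inside L S e + \sum_(e in X) inside L T e +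
   \sum_(e in X) [&& inside L (S :|: T) e, ~~ inside L S e & ~~ inside L T e] =
   \sum_(e in X) inside L (S :|: T) e + \sum_(e in X) inside L (S :&: T) e)%N.
  rewrite -!big_split /=; apply: eq_bigr => e _.
  by rewrite /inside !inE; do ![case: (_ \in _)].
rewrite /excess; lia.
Qed.

Lemma excess_cup L S T :
  excess L S + excess L T <= excess L (S :|: T) + excess L (S :&: T).
Proof. by have := excess_supermod L S T; lia. Qed.

Lemma excess_cup_edge L S T e : e \in X -> inside L (S :|: T) e ->
  ~~ inside L S e -> ~~ inside L T e ->
  excess L S + excess L T + 1 <= excess L (S :|: T) + excess L (S :&: T).
Proof.
move=> eX eU eS eT; have := excess_supermod L S T.
rewrite (bigD1 e) //= eU eS eT /=; lia.
Qed.

(** Removing [b] loses one label and all edges at [b], each counted once as there are no loops.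
    Degrees are therefore read off from the excess of [S :\ b]. *)
Lemma card_star L b S : (forall e, e \in X -> L (e, false) != L (e, true)) ->
  b \in S -> #|star L b S|%:Z = excess L S - excess L (S :\ b) + 1.
Proof.
move=> Lneq bS.
have -> : #|star L b S| = (\sum_(e in X)
    (inside L S e && ((L (e, false) == b) || (L (e, true) == b))))%N.
  rewrite [LHS](_ : _ = \sum_(e in X) \sum_(i : bool | (L (e, i) == b) && inside L S e) 1)%N;
    last by rewrite pair_big_dep -sum1_card; apply: eq_bigl => -[e i]; rewrite inE.
  apply: eq_bigr => e eX; rewrite big_mkcond big_bool /=.
  have := Lneq e eX; case: (inside L S e); rewrite ?andbF ?andbT //=.
  by case: (L (e, false) =P b) => [->|_]; case: (_ =P b) => [->|_] //; rewrite eqxx.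
have := cardsD1 b S; rewrite bS /excess => ->.
have -> : (\sum_(e in X) inside L S e = \sum_(e in X) inside L (S :\ b) e
  + \sum_(e in X) (inside L S e && ((L (e, false) == b) || (L (e, true) == b))))%N.
  rewrite -big_split /=; apply: eq_bigr => e _.
  rewrite /inside !inE; do ![case: (_ \in _) => //=]; by do ![case: (_ == _)].
lia.
Qed.

Lemma excess_edit1 L L' S e1 : e1 \in X -> (forall h, h.1 != e1 -> L' h = L h) ->
  excess L' S + (inside L S e1)%:Z = excess L S + (inside L' S e1)%:Z.
Proof.
move=> X1 Leq; rewrite /excess.
rewrite (bigD1 e1 X1) /= [X in _ = X%:Z - _ + _](bigD1 e1 X1) /=.
rewrite (eq_bigr (fun e => nat_of_bool (inside L S e))); first by lia.
by move=> e /andP[_ n1]; rewrite /inside !Leq.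
Qed.

Lemma excess_edit2 L L' S e1 e2 : e1 \in X -> e2 \in X -> e2 != e1 ->
  (forall h, h.1 != e1 -> h.1 != e2 -> L' h = L h) ->
  excess L' S + (inside L S e1)%:Z + (inside L S e2)%:Z =
  excess L S + (inside L' S e1)%:Z + (inside L' S e2)%:Z.
Proof.
move=> X1 X2 n12 Leq; rewrite /excess.
have X21 : (e2 \in X) && (e2 != e1) by rewrite X2.
rewrite (bigD1 e1 X1) (bigD1 e2 X21) /=.
rewrite [X in _ = X%:Z - _ + _ + _](bigD1 e1 X1) [X in _ = (_ + X)%:Z - _ + _ + _](bigD1 e2 X21) /=.
rewrite (eq_bigr (fun e => nat_of_bool (inside L S e))); first by lia.
by move=> e /andP[/andP[_ n1] n2]; rewrite /inside !Leq.
Qed.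

(** A degree sum: it counts the edges of [S] that meet [D], and those inside [D] once more. *)
Lemma sum_star L S D : D \subset S ->
  (forall e, e \in X -> L (e, false) != L (e, true)) ->
  \sum_(x in D) (excess L S - excess L (S :\ x) + 1) =
  excess L S + excess L D - excess L (S :\: D) + (#|D|).*2%:Z.
Proof.
move=> sDS Lneq.
rewrite (eq_bigr (fun x => #|star L x S|%:Z)); last first.
  by move=> x xD; rewrite card_star // (subsetP sDS).
rewrite (eq_bigr (fun x => #|star L x S|%:R)); last by move=> x _; rewrite natz.
rewrite -natr_sum natz.
have -> : (\sum_(x in D) #|star L x S| = \sum_(e in X) inside L S e *
    ((L (e, false) \in D) + (L (e, true) \in D)))%N.
  rewrite (eq_bigr (fun x => \sum_(h | (h.1 \in X) && inside L S h.1) (L h == x))%N).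
    rewrite exchange_big /=.
    rewrite (eq_bigr (fun h => nat_of_bool (L h \in D))); last first.
      move=> h _; have [hD|hD] := boolP (L h \in D).
        rewrite (bigD1 (L h)) //= eqxx big1 // => x /andP[_ /negPf].
        by rewrite eq_sym => ->.
      by rewrite big1 // => x xD; case: eqP => // lx; rewrite lx xD in hD.
    rewrite [LHS](_ : _ = \sum_(e in X) \sum_(i : bool | inside L S e) (L (e, i) \in D))%N;
      last by rewrite pair_big_dep; apply: eq_big => -[].
    apply: eq_bigr => e _; rewrite big_mkcond big_bool /=.
    by case: (inside L S e); rewrite ?mul0n // mul1n addnC.
  move=> x _; rewrite -sum1_card big_mkcond [RHS]big_mkcond /=; apply: eq_bigr => h _.
  by rewrite !inE; case: (h.1 \in X); case: (L h == x); case: (inside L S h.1).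
have : (\sum_(e in X) inside L S e * ((L (e, false) \in D) + (L (e, true) \in D)) +
    \sum_(e in X) inside L (S :\: D) e =
  \sum_(e in X) inside L S e + \sum_(e in X) inside L D e)%N.
  rewrite -!big_split /=; apply: eq_bigr => e _; rewrite /inside !inE.
  have sD x : x \in D -> x \in S by exact: (subsetP sDS).
  have := sD (L (e, false)); have := sD (L (e, true)).
  by do ![case: (_ \in _) => //=]; move=> // A B; try (have := A isT); try (have := B isT).
have := cardsD S D; rewrite (setIidPr sDS); have := subset_leq_card sDS.
by rewrite /excess; lia.
Qed.

Definition core L S0 : Prop :=
  [/\ excess L S0 = 1, forall S, excess L S <= 1 &
      forall S, 1 <= excess L S -> S0 \subset S].

(** As unions have excess at most 1, supermodularity keeps the intersection of two overfull sets
    overfull. *)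
Lemma ex_core L : (forall S, excess L S <= 1) -> (exists S, 1 <= excess L S) ->
  exists S0, core L S0.
Proof.
move=> le1 [S1 S1P].
case: (arg_minnP (fun S : {set C} => #|S|) (P := fun S => 1 <= excess L S) S1P).
move=> S0 S0P S0min; exists S0; split=> // [|S SP].
  by have := le1 S0; lia.
have := excess_cup L S S0; have := le1 (S :|: S0) => A B.
have /S0min : 1 <= excess L (S :&: S0) by lia.
by move=> cI; apply/setIidPr/eqP; rewrite eqEcard subsetIr.
Qed.

End Excess.

Arguments excess_cup {E C X} L S T.

(** * Orienting edges towards distinct labels *)

Section Orientation.

Variables (E C : finType) (L : E * bool -> C).

(* [U] is the set of labels used so far; an edge cannot take its label [p]
   exactly when [p] lies in a set that is tight for the other edges, and then
   the union of two such sets would violate the hypothesis. *)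
Lemma orientation_avoiding n (X : {set E}) (U : {set C}) : #|X| = n ->
  (forall S, (\sum_(e in X) inside L S e <= #|S :\: U|)%N) ->
  exists phi : E -> bool, {in X &, injective (fun e => L (e, phi e))} /\
    {in X, forall e, L (e, phi e) \notin U}.
Proof.
elim: n X U => [|n IH] X U.
  move=> /eqP; rewrite cards_eq0 => /eqP -> _; exists xpredT.
  by split=> [e e'|e]; rewrite inE.
move=> cX hall.
have /set0Pn[e eX] : X != set0 by rewrite -cards_eq0 cX.
have cX' : #|X :\ e| = n by have := cardsD1 e X; rewrite eX cX => -[].
pose tight i := [exists S : {set C}, (L (e, i) \in S) &&
  (#|S :\: U| <= \sum_(e' in X :\ e) inside L S e')%N].
have sumX S : (\sum_(e' in X) inside L S e' =
    inside L S e + \sum_(e' in X :\ e) inside L S e')%N.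
  by rewrite (bigD1 e) //=; congr addn; apply: eq_bigl => x; rewrite !inE andbC.
have [/andP[/existsP[S /andP[eS tS]] /existsP[T /andP[eT tT]]]|] :=
    boolP (tight false && tight true).
  have := hall (S :|: T); rewrite sumX.
  have -> : inside L (S :|: T) e by rewrite /inside !inE eS eT orbT.
  have := hall (S :&: T); rewrite sumX.
  have := cardsUI (S :\: U) (T :\: U); rewrite -setDUl.
  have -> : (S :\: U) :&: (T :\: U) = (S :&: T) :\: U.
    by apply/setP => x; rewrite !inE; case: (x \in U); rewrite //= andbF.
  have : (\sum_(e' in X :\ e) inside L S e' + \sum_(e' in X :\ e) inside L T e' <=
    \sum_(e' in X :\ e) inside L (S :|: T) e' +
    \sum_(e' in X :\ e) inside L (S :&: T) e')%N.
    rewrite -!big_split /=; apply: leq_sum => e' _.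
    by rewrite /inside !inE; do ![case: (_ \in _)].
  lia.
move=> ntight; have {ntight} [i /existsPn ni] : exists i, ~~ tight i.
  by case/nandP: ntight => ?; [exists false|exists true].
have iU : L (e, i) \notin U.
  apply/negP => iU; have := ni [set L (e, i)]; rewrite set11 /=.
  suff -> : [set L (e, i)] :\: U = set0 by rewrite cards0.
  by apply/setP => x; rewrite !inE; case: eqP => [->|]; rewrite ?iU ?andbF.
have [S|phi [phi_inj phiU]] := IH (X :\ e) (L (e, i) |: U) cX'.
  have := hall S; rewrite sumX.
  have := ni S; have [iS /=|iS _] := boolP (L (e, i) \in S).
    rewrite -ltnNge setUC -setDDl => lt _.
    by have := cardsD1 (L (e, i)) (S :\: U); rewrite inE iU iS; lia.
  suff -> : S :\: (L (e, i) |: U) = S :\: U by lia.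
  apply/setP => x; rewrite !inE; case: eqP => // ->.
  by rewrite (negPf iS) !andbF.
pose psi e' := if e' == e then i else phi e'.
have psiE e' : e' \in X -> e' != e ->
    [/\ psi e' = phi e', e' \in X :\ e & L (e', psi e') != L (e, i)].
  move=> e'X ne; have e'X' : e' \in X :\ e by rewrite !inE ne.
  rewrite /psi (negPf ne); split=> //; apply: contraTneq (phiU _ e'X') => ->.
  by rewrite !inE eqxx.
have psie : psi e = i by rewrite /psi eqxx.
exists psi; split=> [e1 e2 X1 X2|e1 X1].
  have [->|n1] := eqVneq e1 e; have [->|n2] := eqVneq e2 e; rewrite ?psie //.
  - by have [_ _ /eqP ne] := psiE _ X2 n2 => /esym/ne.
  - by have [_ _ /eqP ne] := psiE _ X1 n1 => /ne.
  - have [-> X1' _] := psiE _ X1 n1; have [-> X2' _] := psiE _ X2 n2.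
    exact: phi_inj.
have [->|n1] := eqVneq e1 e; first by rewrite psie.
have [-> X1' _] := psiE _ X1 n1; have := phiU _ X1'.
by rewrite !inE negb_or => /andP[].
Qed.

Lemma excess_orientation (X : {set E}) : (forall S, excess X L S <= 0) ->
  exists phi : E -> bool, {in X &, injective (fun e => L (e, phi e))}.
Proof.
move=> le0; have [|phi [] //] := @orientation_avoiding #|X| X set0 erefl.
  by move=> S; have := le0 S; rewrite /excess setD0; lia.
by exists phi.
Qed.

End Orientation.

(** * Relabelling two half-edges *)

Section Game.

Variables (E C : finType) (X : {set E}) (neg : C -> C).
Implicit Types (L : E * bool -> C) (S T D : {set C}) (e : E) (h g : E * bool).

Hypothesis negK : involutive neg.
Hypothesis neg_neq : forall c, neg c != c.

Local Notation excess := (excess X).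
Local Notation star := (star X).
Local Notation core := (core X).
Local Notation excess_cup := (@excess_cup _ _ X).

Definition proper_labels L := forall e, e \in X -> L (e, false) != L (e, true).

Lemma opp_halfK h : opp_half (opp_half h) = h.
Proof. by case: h => e i; rewrite /opp_half /= negbK. Qed.

Lemma opp_half_neq h : (opp_half h == h) = false.
Proof. by apply/negP; case: h => e [] /eqP []. Qed.

Lemma same_edge h g : g.1 = h.1 -> g = h \/ g = opp_half h.
Proof. by case: h => e []; case: g => e' [] /= ->; [left|right|right|left]. Qed.

Lemma proper_opp L h : proper_labels L -> h.1 \in X -> L (opp_half h) != L h.
Proof. by move=> pL; case: h => e [] /pL; rewrite // eq_sym. Qed.

Lemma starP L b S h :
  reflect [/\ h.1 \in X, L h = b, b \in S & L (opp_half h) \in S] (h \in star L b S).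
Proof.
rewrite inE insideE; apply: (iffP and3P) => [[hX /eqP <- /andP[]]|[hX lh bS oS]].
  by split.
by rewrite lh eqxx bS oS.
Qed.

Arguments starP {L b S h}.

Lemma star_sub L b S T : S \subset T -> star L b S \subset star L b T.
Proof.
move=> /subsetP sST; apply/subsetP => h /starP[hX lh bS oS].
by apply/starP; split=> //; exact: sST.
Qed.

Lemma excess0 L : excess L set0 = 0.
Proof. by rewrite excessE cards0 big1 // => e _; rewrite /inside inE. Qed.

Lemma excess_setD1 L S c : c \in S -> proper_labels L ->
  excess L S = excess L (S :\ c) - 1 + #|star L c S|%:Z.
Proof. by move=> cS pL; rewrite card_star //; lia. Qed.

Lemma excess_setU1 L S c : c \notin S -> proper_labels L ->
  excess L (c |: S) = excess L S - 1 + #|star L c (c |: S)|%:Z.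
Proof. by move=> cS pL; rewrite (@excess_setD1 _ _ c) ?setU11 // setU1K. Qed.

Lemma excess1 L c : proper_labels L -> excess L [set c] = -1.
Proof.
move=> pL; have -> : [set c] = c |: set0 by rewrite setU0.
rewrite excess_setU1 ?inE // excess0.
suff -> : star L c (c |: set0) = set0 by rewrite cards0.
apply/setP => h; rewrite [RHS]inE; apply/starP => -[hX lh _].
by rewrite !inE orbF -lh (negPf (proper_opp pL hX)).
Qed.

Lemma excess_add2 L S c g1 g2 : proper_labels L -> c \notin S ->
  g1 != g2 -> g1.1 \in X -> g2.1 \in X -> L g1 = c -> L g2 = c ->
  excess L S - 1 + (L (opp_half g1) \in S)%:Z + (L (opp_half g2) \in S)%:Z
    <= excess L (c |: S).
Proof.
move=> pL cS n12 X1 X2 l1 l2; rewrite excess_setU1 //.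
suff : ((L (opp_half g1) \in S) + (L (opp_half g2) \in S) <= #|star L c (c |: S)|)%N by lia.
have st g : g.1 \in X -> L g = c -> L (opp_half g) \in S -> g \in star L c (c |: S).
  by move=> gX lg gS; apply/starP; rewrite !inE eqxx gS orbT.
have := st _ X1 l1; have := st _ X2 l2.
case: (_ \in S) => [/(_ isT) s2|_]; case: (_ \in S) => [/(_ isT) s1|_] //.
- apply: (@leq_trans #|[set g1; g2]|); first by rewrite cards2 n12.
  by apply/subset_leq_card/subsetP => g /set2P[] ->.
- by rewrite (cardD1 g2) s2.
- by rewrite (cardD1 g1) s1.
Qed.

Definition swap a b c :=
  if c == a then b else if c == b then a else
  if c == neg a then neg b else if c == neg b then neg a else c.

Definition recolor a b L h g : E * bool -> C :=
  fun h' => if (h' == h) || (h' == g) then swap a b (L h') else L h'.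

(* The half-edge [g], labelled by the negative of [a] or [b], must keep its
   label if [h] is relabelled from [b] to [a]. *)
Definition harmful L S0 a b h g := g.1 != h.1 /\ exists S,
  [/\ L g \notin S, swap a b (L g) \in S, L (opp_half g) \in S,
      1 - (a \in S)%:Z <= excess L (S :|: S0) &
      L g \in S0 -> [/\ L (opp_half g) \in S0, excess L (S :&: S0) = 0 &
        ~~ inside L (S :&: S0) h.1]].

Section Core.

Variables (L : E * bool -> C) (S0 : {set C}) (a : C).
Hypotheses (pL : proper_labels L) (cS0 : core L S0).
Hypothesis free_a : forall S, a \in S -> excess L S <= 0.

Lemma core_proper D : ~~ (S0 \subset D) -> excess L D <= 0.
Proof. by case: cS0 => _ _ sub nD; rewrite leNgt; apply: contra nD => ?; apply: sub; lia. Qed.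

Lemma core_notin D x : x \in S0 -> x \notin D -> excess L D <= 0.
Proof.
by move=> xS0 xD; apply/core_proper; apply: contra xD => /subsetP; apply.
Qed.

Lemma free_notin T : 1 <= excess L T -> a \notin T.
Proof. by move=> T1; apply/negP => /free_a; lia. Qed.

(** Otherwise adding [a] to [T] would cost one label and gain this edge, giving an overfull set
    through [a]. *)
Lemma free_edge T g : 1 <= excess L T -> g.1 \in X -> L g = a ->
  L (opp_half g) \notin T.
Proof.
move=> T1 gX lg; apply/negP => oT; have aT := free_notin T1.
have := @excess_cup_edge _ _ X L [set a] T _ gX.
have oa : L (opp_half g) != a by rewrite -lg proper_opp.
rewrite !insideE lg !inE oT eqxx (negPf aT) (negPf oa) orbT /=.
rewrite excess1 // => /(_ isT isT isT).
have -> : [set a] :&: T = set0 by apply/setP => x; rewrite !inE; case: (x =P a) => //= ->; rewrite (negPf aT).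
have := free_a (setU11 a T); rewrite excess0; lia.
Qed.

Variables (b : C) (h : E * bool).
Hypothesis (hb : h \in star L b S0).

(** The left side is the excess of [S] after [h] alone is moved from [b] to [a]. Such a move would
    leave no overfull set, so any failure of a Kempe change is due to its second half-edge. *)
Lemma move_excess S : excess L S + ((a \in S) && (L (opp_half h) \in S))%:Z
  - ((b \in S) && (L (opp_half h) \in S))%:Z <= 0.
Proof.
have [f1 le1 sub] := cS0; have [hX lh bS0 xS0] := starP hb.
have := excess_cup L S S0; have := le1 S; have := le1 (S :|: S0).
have aU : a \in S -> excess L (S :|: S0) <= 0.
  by move=> aS; apply: free_a; rewrite inE aS.
have [aS|aS] := boolP (a \in S).
  have := free_a aS; have := aU aS.
  have [bS|bS] := boolP (b \in S); first by rewrite /=; lia.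
  have : excess L (S :&: S0) <= 0.
    by apply: (@core_notin _ b) => //; rewrite inE (negPf bS).
  by rewrite /=; lia.
have [/subsetP sS|nS] := boolP (S0 \subset S); last by have := core_proper nS; rewrite /=; lia.
by rewrite !sS //=; lia.
Qed.

(** By [move_excess], an overfull set after the change needs [g] to move into it. If [L g = a] this
    is impossible, since edges at [a] do not end in overfull sets. If [L g = b], both half-edges at
    a label of degree two have moved, and [a] merely takes the place of [b]. Otherwise the new
    overfull set witnesses that [g] is harmful. *)
Lemma recolor_step g : g.1 \in X ->
  (exists S, 1 <= excess (recolor a b L h g) S) ->
  [/\ excess L (S0 :\ b) = 0, g \in star L b S0 & g != h] \/
  [/\ b != neg a, L g = neg a \/ L g = neg b & harmful L S0 a b h g].
Proof.
move=> gX [S]; have [f1 le1 sub] := cS0; have [hX lh bS0 xS0] := starP hb.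
have mS := move_excess S.
have aS0 : a \notin S0 by apply: free_notin; rewrite f1.
have nab : b != a by apply: contraNneq aS0 => <-.
have swapb : swap a b b = a by rewrite /swap (negPf nab) eqxx.
set x := L (opp_half h) in xS0 mS *; set L' := recolor a b L h g.
have L'h : L' h = a by rewrite /L' /recolor eqxx /= lh swapb.
have aU : a \in S -> excess L (S :|: S0) <= 0.
  by move=> aS; apply: free_a; rewrite inE aS.
have cupS := excess_cup L S S0.
have fS1 : 1 <= excess L S -> b \in S /\ x \in S.
  by move=> /sub /subsetP sS; rewrite !sS.
have L'off h' : h'.1 != h.1 -> h'.1 != g.1 -> L' h' = L h'.
  move=> nh ng; rewrite /L' /recolor; case: (h' =P h) nh => [->|_ _]; first by rewrite eqxx.
  by case: (h' =P g) ng => [->|//]; rewrite eqxx.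
have aX : x != a by apply: contraNneq aS0 => <-.
have bX : x != b by rewrite -lh; apply: proper_opp.
have [eg|neg1] := eqVneq g.1 h.1.
  have L'off1 h' : h'.1 != h.1 -> L' h' = L h' by move=> nh; apply: L'off; rewrite ?eg.
  have := excess_edit1 S hX L'off1; rewrite !insideE lh -/x L'h => fS'.
  have [L'x|[c [nbc cx L'x]]] : L' (opp_half h) = x \/
      exists c, [/\ b != neg a, x = neg a \/ x = neg b & L' (opp_half h) = c].
    rewrite /L' /recolor opp_half_neq /=; case: eqP => _; last by left.
    rewrite /swap -/x (negPf aX) (negPf bX).
    have [xa|_] := eqVneq x (neg a).
      by right; exists (neg b); split; auto; rewrite -xa; rewrite eq_sym.
    have [xb|_] := eqVneq x (neg b); last by left.
    right; exists (neg a); split; auto; apply: contraNneq aX => bna.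
    by rewrite xb bna negK.
  - by rewrite L'x in fS' => S1; exfalso; move: fS' mS S1; clear; lia.
  - rewrite L'x in fS' => S1; exfalso.
    have [aS|aS] := boolP (a \in S).
      have [/fS1[bS xS]|n1] : 1 <= excess L S \/ excess L S <= 0.
          by move: (excess L S) => z; clear; lia.
        by move: fS' S1 (free_a aS); rewrite bS xS; clear; lia.
      have : 1 <= excess L (S :&: S0).
        by move: (aU aS) fS' S1 n1 cupS f1; rewrite aS; clear; lia.
      move=> /sub /subsetP sI; have := sI _ bS0; have := sI _ xS0.
      rewrite !inE => /andP[xS _] /andP[bS _].
      by move: (free_a aS) fS' S1; rewrite bS xS; clear; lia.
    have [bS xS] : b \in S /\ x \in S.
      by apply: fS1; move: fS' S1; rewrite (negPf aS); clear; lia.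
    by move: (le1 S) fS' S1; rewrite (negPf aS) bS xS; clear; lia.
have := @excess_edit2 _ _ X _ _ S h.1 g.1 hX gX neg1 L'off.
have ohg : (opp_half h == g) = false by apply: contraNF neg1 => /eqP <-.
have hg : (h == g) = false by apply: contraNF neg1 => /eqP <-.
have L'oh : L' (opp_half h) = x by rewrite /L' /recolor opp_half_neq ohg.
have L'og : L' (opp_half g) = L (opp_half g).
  rewrite /L' /recolor opp_half_neq orbF; case: eqP => // ogh.
  by rewrite -ogh eqxx in neg1.
have L'g : L' g = swap a b (L g) by rewrite /L' /recolor eqxx orbT.
rewrite !insideE lh L'h L'oh L'og L'g -/x; set y := L (opp_half g) => fS' S1.
have fS1' : 1 <= excess L S \/ excess L S <= 0.
  by move: (excess L S) => z; clear; lia.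
have IS0 z : z \in S0 -> z \notin S -> excess L (S :&: S0) <= 0.
  by move=> zS0 zS; apply: (@core_notin _ z) => //; rewrite inE (negPf zS).
have free1 T := @free_edge T g ^~ gX.
have pLg := proper_opp pL gX; rewrite -/y in pLg.
have edge_cup : L g \in S0 -> L g \notin S -> y \in S -> y \notin S0 ->
    excess L S + excess L S0 + 1 <= excess L (S :|: S0) + excess L (S :&: S0).
  move=> gS0 gS yS yS0; apply: (@excess_cup_edge _ _ X _ _ _ _ gX);
    by rewrite insideE ?inE ?gS0 -?/y ?yS ?orbT ?(negPf gS) ?(negPf yS0) ?andbF.
have [gb|gb] := eqVneq (L g) b.
  left; rewrite gb swapb in fS' edge_cup.
  have [bS|bS] := boolP (b \in S).
    exfalso; have [aS|aS] := boolP (a \in S); last first.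
      by move: mS fS' S1; rewrite bS (negPf aS); clear; lia.
    by move: mS fS' S1; rewrite bS aS; clear; lia.
  have aS : a \in S.
    apply/negPn/negP => aS; exfalso.
    by move: mS fS' S1; rewrite (negPf bS) (negPf aS); clear; lia.
  have U0 := aU aS; have I0 := IS0 _ bS0 bS.
  have yS0 : y \in S0.
    apply/negPn/negP => yS0; have yS : y \in S.
      apply/negPn/negP => yS; move: cupS U0 I0 f1 fS' S1.
      by rewrite (negPf bS) aS (negPf yS); clear; lia.
    move: (edge_cup bS0 bS yS yS0) U0 I0 f1 fS' S1.
    by rewrite (negPf bS) aS yS; clear; lia.
  have [xS yS] : x \in S /\ y \in S.
    move: cupS U0 I0 f1 fS' S1; rewrite (negPf bS) aS; clear.
    by case: (x \in S); case: (y \in S); rewrite /=; split => //; lia.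
  have fI : excess L (S :&: S0) = 0.
    by move: cupS U0 I0 f1 fS' S1; rewrite (negPf bS) aS xS yS; clear; lia.
  split; last by apply: contraFneq hg => ->.
    (* Both edges at [b] end in the tight set [S :&: S0], so adding [b] makes it overfull; as the
       core is least, only [b] was missing. *)
    have := @excess_add2 L (S :&: S0) b h g pL _ _ hX gX lh gb.
    rewrite !inE (negPf bS) eq_sym -/x -/y xS yS xS0 yS0 fI eq_sym hg.
    move=> /(_ isT isT) f2; have /sub sUI : 1 <= excess L (b |: S :&: S0).
      by move: f2; clear; lia.
    suff -> : S0 :\ b = S :&: S0 by [].
    apply/setP => z; rewrite !inE; have := subsetP sUI z.
    rewrite !inE; case: (z =P b) => [->|_] /=; first by rewrite (negPf bS).
    by case: (z \in S0) => [/(_ isT)|_]; rewrite ?andbT ?andbF // => ->.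
  by apply/starP.
have [ga|ga] := eqVneq (L g) a.
  exfalso; have swapa : swap a b (L g) = b by rewrite /swap ga eqxx.
  rewrite swapa ga in fS'.
  have [bS yS aS] : [/\ b \in S, y \in S & a \notin S].
    move: mS fS' S1; clear; case: (a \in S); case: (b \in S); case: (y \in S);
      by rewrite /=; split => //; lia.
  have [/free1|n1] := fS1'; first by rewrite -/y yS => /(_ ga).
  have nxS : x \notin S.
    by apply/negP => xS; move: n1 fS' S1; rewrite bS yS (negPf aS) xS; clear; lia.
  have : 1 <= excess L (S :|: S0).
    move: (IS0 _ xS0 nxS) cupS f1 fS' S1.
    by rewrite bS yS (negPf aS) (negPf nxS); clear; lia.
  by move=> /free1 /(_ ga); rewrite inE -/y yS.
have swap_fix : L g != neg a -> L g != neg b -> False.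
  move=> na nb; have swapg : swap a b (L g) = L g.
    by rewrite /swap (negPf gb) (negPf ga) (negPf na) (negPf nb).
  by rewrite swapg in fS'; move: mS fS' S1; clear; lia.
have bna : b != neg a.
  apply/negP => /eqP bna; apply: swap_fix; first by rewrite -bna.
  by rewrite bna negK.
right; split=> //.
  have [->|na] := eqVneq (L g) (neg a); first by left.
  have [->|nb] := eqVneq (L g) (neg b); first by right.
  by case: swap_fix.
split=> //; exists S.
have [cS yS gS mS0] : [/\ swap a b (L g) \in S, y \in S, L g \notin S &
    excess L S + ((a \in S) && (x \in S))%:Z = ((b \in S) && (x \in S))%:Z].
  move: mS fS' S1; clear; case: (swap a b (L g) \in S); case: (y \in S);
    by case: (L g \in S); rewrite /=; split => //; lia.
have nbx : L g \in S0 -> b \in S -> x \in S -> a \in S -> False.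
  move=> gS0 bS xS aS; have := IS0 _ gS0 gS.
  by move: (aU aS) cupS f1 mS0; rewrite aS bS xS; clear; lia.
have nbx' : L g \in S0 -> b \in S -> x \in S -> False.
  move=> gS0 bS xS; have [/nbx|aS] := boolP (a \in S); first exact.
  have /sub /subsetP /(_ _ gS0) : 1 <= excess L S.
    by move: mS0; rewrite (negPf aS) bS xS; clear; lia.
  by rewrite (negPf gS).
have nbI : ~~ ((b \in S) && (x \in S)) -> excess L (S :&: S0) <= 0.
  by case/nandP => [bS|xS]; [exact: (IS0 b)|exact: (IS0 x)].
have lowS : 1 - (a \in S)%:Z <= excess L (S :|: S0).
  move: mS0 (le1 (S :&: S0)) cupS f1 nbI; clear.
  by case: (a \in S); case: (b \in S); case: (x \in S) => //=; lia.
split=> // gS0.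
have I0 := IS0 _ gS0 gS.
have nbxS : ~~ ((b \in S) && (x \in S)).
  by apply/negP => /andP[]; exact: nbx'.
have lowf : - (a \in S)%:Z <= excess L S.
  move: mS0 nbxS; clear.
  by case: (a \in S); case: (b \in S); case: (x \in S) => //=; lia.
have upU : excess L (S :|: S0) <= 1 - (a \in S)%:Z.
  have [/aU|_] := boolP (a \in S); rewrite /= ?subrr // ?subr0; exact: le1.
split.
- apply/negPn/negP => yS0; have := edge_cup gS0 gS yS yS0.
  by move: lowf upU I0 f1; clear; lia.
- by move: lowf upU I0 f1 cupS; clear; lia.
- by rewrite insideI insideE lh -/x (negPf nbxS).
Qed.

End Core.
End Game.

Arguments starP {E C X L b S h}.
Arguments star_sub {E C X} L b {S T}.

(** * Two half-edges at one label of the core *)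

Section Pairs.

Variables (E C : finType) (X : {set E}) (neg : C -> C).
Implicit Types (S T D : {set C}) (e : E) (g : E * bool).

Hypothesis negK : involutive neg.

Local Notation excess := (excess X).
Local Notation star := (star X).
Local Notation core := (core X).
Local Notation harmful := (harmful X neg).

Variables (L : E * bool -> C) (S0 : {set C}) (a : C).
Hypotheses (pL : proper_labels X L) (cS0 : core L S0).
Hypothesis free_a : forall S, a \in S -> excess L S <= 0.

Lemma card_star_core x : x \in S0 -> #|star L x S0|%:Z = 2 - excess L (S0 :\ x).
Proof. by case: cS0 => f1 _ _ xS0; rewrite card_star // f1; clear; lia. Qed.

(** Let [S1], [S2] witness the harm. If [c] were outside the core, adding [c] to the union of [S1],
    [S2] and the core would give excess 2 or an overfull set through [a]. So [c] is in the core and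
    the traces [W1], [W2] of the witnesses are tight; [c] is joined to both, hence their union with
    [c] is overfull and equals the core. The set [B] is [W1 :&: W2]. *)
Lemma two_harmful b h1 h2 g1 g2 c : h1 \in star L b S0 -> h2 \in star L b S0 ->
  g1 != g2 -> g1.1 \in X -> g2.1 \in X -> L g1 = c -> L g2 = c -> c != b ->
  harmful L S0 a b h1 g1 -> harmful L S0 a b h2 g2 ->
  [/\ c \in S0, excess L (S0 :\ c) = 0, g1 \in star L c S0, g2 \in star L c S0 &
    exists B : {set C}, [/\ B \subset S0, excess L B = 0, b \in B, c \notin B &
      L (opp_half h1) \notin B /\ L (opp_half h2) \notin B]].
Proof.
move=> hb1 hb2 n12 X1 X2 l1 l2 ncb [e1 [S1]] + [e2 [S2]]; rewrite l1 l2.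
move=> [cS1 _ yS1 u1 k1] [cS2 _ yS2 u2 k2].
have [f1 le1 sub] := cS0; have [_ lh1 bS0 x1S0] := starP hb1.
have [hX2 lh2 _ x2S0] := starP hb2; have [hX1 _ _ _] := starP hb1.
have cup := @excess_cup _ _ X L.
have [cS0'|cS0'] := boolP (c \in S0); last first.
  exfalso; pose Y1 := S1 :|: S0; pose Y2 := S2 :|: S0.
  have cY : c \notin Y1 :|: Y2.
    by rewrite !inE (negPf cS1) (negPf cS2) (negPf cS0').
  have := excess_add2 pL cY n12 X1 X2 l1 l2; rewrite !inE yS1 yS2 !orbT.
  have aS0 : a \notin S0 by apply: (free_notin free_a); rewrite f1.
  have aY1 : (a \in Y1) = (a \in S1) by rewrite inE (negPf aS0) orbF.
  have aY2 : (a \in Y2) = (a \in S2) by rewrite inE (negPf aS0) orbF.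
  have := cup Y1 Y2; move: u1 u2; rewrite -/Y1 -/Y2.
  have := le1 (Y1 :&: Y2); have := le1 (c |: (Y1 :|: Y2)).
  have fI : a \in S1 -> a \in S2 -> excess L (Y1 :&: Y2) <= 0.
    by move=> a1 a2; apply: free_a; rewrite inE aY1 aY2 a1.
  have fU : (a \in S1) || (a \in S2) -> excess L (c |: (Y1 :|: Y2)) <= 0.
    by move=> a12; apply: free_a; rewrite inE [a \in _ :|: _]inE aY1 aY2 a12 orbT.
  by move: fI fU; clear; case: (a \in S1); case: (a \in S2) => /=; lia.
have [yS01 fW1 eW1] := k1 cS0'; have [yS02 fW2 eW2] := k2 cS0'.
pose W1 := S1 :&: S0; pose W2 := S2 :&: S0; pose B := W1 :&: W2.
rewrite -/W1 -/W2 in fW1 fW2 eW1 eW2.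
have sW1 : W1 \subset S0 by apply: subsetIr.
have sW2 : W2 \subset S0 by apply: subsetIr.
have cW1 : c \notin W1 by rewrite inE (negPf cS1).
have cW2 : c \notin W2 by rewrite inE (negPf cS2).
have cU : c \notin W1 :|: W2 by rewrite inE negb_or cW1.
have yW1 : L (opp_half g1) \in W1 by rewrite inE yS1.
have yW2 : L (opp_half g2) \in W2 by rewrite inE yS2.
have fU : excess L (W1 :|: W2) <= 0 := core_notin cS0 cS0' cU.
have cB : c \notin B by rewrite inE (negPf cW1).
have fB : excess L B <= 0 := core_notin cS0 cS0' cB.
have cupW := cup W1 W2; rewrite -/B in cupW.
have [fU0 fB0] : excess L (W1 :|: W2) = 0 /\ excess L B = 0.
  by move: fU fB cupW; rewrite fW1 fW2; clear; lia.
have UE : c |: (W1 :|: W2) = S0.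
  apply/eqP; rewrite eqEsubset; apply/andP; split.
    by rewrite subUset sub1set cS0' subUset sW1.
  apply: sub; have := excess_add2 pL cU n12 X1 X2 l1 l2.
  by rewrite fU0 !in_setU yW1 yW2 !orbT; clear; lia.
have fc : excess L (S0 :\ c) = 0 by rewrite -UE setU1K.
have g1s : g1 \in star L c S0 by apply/starP.
have g2s : g2 \in star L c S0 by apply/starP.
have stc : star L c S0 = [set g1; g2].
  have le2 : (#|star L c S0| <= 2)%N.
    by have := card_star_core cS0'; rewrite fc; clear; lia.
  by apply/esym/eqP; rewrite eqEcard cards2 n12 subUset !sub1set g1s g2s.
have inU z : z \in S0 -> z != c -> z \in W1 :|: W2.
  by rewrite -{1}UE in_setU1 => /orP[->|].
have bU : b \in W1 :|: W2 by apply: inU; rewrite // eq_sym.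
(* An edge between [W1] and [W2] but in neither would make [W1 :|: W2] have
   positive excess. *)
have noedge h : h.1 \in X -> L h \in W1 :|: W2 -> L (opp_half h) \in W1 :|: W2 ->
    inside L W1 h.1 || inside L W2 h.1.
  move=> hX hU oU; apply/norP => -[i1 i2].
  have := excess_cup_edge hX _ i1 i2; rewrite insideE hU oU => /(_ isT).
  by rewrite fW1 fW2 fU0 -/B fB0; clear; lia.
(* If the edge of [h1] ends at [c], it is the edge of [g2], whose other end lies in [W2]. Otherwise
   it lies within [W1 :|: W2] but not inside [W1], hence inside [W2]. *)
have bW2 : b \in W2.
  have [ox|/(inU _ x1S0) xU] := eqVneq (L (opp_half h1)) c.
    have : opp_half h1 \in star L c S0 by apply/starP; rewrite opp_halfK lh1.
    rewrite stc => /set2P[og|og]; first by rewrite -og eqxx in e1.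
    by rewrite -lh1 -(opp_halfK h1) og.
  have := noedge h1 hX1; rewrite lh1 => /(_ bU xU).
  by rewrite (negPf eW1) insideE lh1 => /andP[].
have bW1 : b \in W1.
  have [ox|/(inU _ x2S0) xU] := eqVneq (L (opp_half h2)) c.
    have : opp_half h2 \in star L c S0 by apply/starP; rewrite opp_halfK lh2.
    rewrite stc => /set2P[og|og]; last by rewrite -og eqxx in e2.
    by rewrite -lh2 -(opp_halfK h2) og.
  have := noedge h2 hX2; rewrite lh2 => /(_ bU xU).
  by rewrite (negPf eW2) insideE lh2 orbF => /andP[].
have x1W : L (opp_half h1) \notin W1 by move: eW1; rewrite insideE lh1 bW1.
have x2W : L (opp_half h2) \notin W2 by move: eW2; rewrite insideE lh2 bW2.
split=> //; exists B; split=> //.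
- by apply: subset_trans sW1; apply: subsetIl.
- by rewrite inE bW1.
- by split; rewrite in_setI ?(negPf x1W) ?(negPf x2W) ?andbF.
Qed.

(* Relabelling the two edges at [b] puts [a] in the core in place of [b]. *)
Lemma replace_core b h1 h2 : h1 \in star L b S0 -> h2 \in star L b S0 ->
  h2 != h1 -> excess L (S0 :\ b) = 0 ->
  let L' := recolor neg a b L h1 h2 in
  [/\ core L' (a |: S0 :\ b), forall S, b \in S -> excess L' S <= 0 &
    forall y, y \in S0 -> y != b ->
      excess L' ((a |: S0 :\ b) :\ y) <= excess L (S0 :\ y)].
Proof.
move=> hb1 hb2 n21 fb L'; have [f1 le1 sub] := cS0.
have [hX1 lh1 bS0 xS0] := starP hb1; have [hX2 lh2 _ yS0] := starP hb2.
have aS0 : a \notin S0 by apply: (free_notin free_a); rewrite f1.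
have nab : b != a by apply: contraNneq aS0 => <-.
have swapb : swap neg a b b = a by rewrite /swap (negPf nab) eqxx.
have ne21 : h2.1 != h1.1.
  apply: contraNneq n21 => /same_edge [->//|h2E].
  by move: (proper_opp pL hX1); rewrite -h2E lh1 lh2 eqxx.
have fS' S : excess L' S + ((b \in S) && (L (opp_half h1) \in S))%:Z +
    ((b \in S) && (L (opp_half h2) \in S))%:Z =
    excess L S + ((a \in S) && (L (opp_half h1) \in S))%:Z +
    ((a \in S) && (L (opp_half h2) \in S))%:Z.
  have L'off h' : h'.1 != h1.1 -> h'.1 != h2.1 -> L' h' = L h'.
    rewrite /L' /recolor; case: (h' =P h1) => [->|_]; first by rewrite eqxx.
    by case: (h' =P h2) => [->|//]; rewrite eqxx.
  have := excess_edit2 S hX1 hX2 ne21 L'off.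
  have o12 : (opp_half h1 == h2) = false by apply: contraNF ne21 => /eqP <-.
  have o21 : (opp_half h2 == h1) = false by apply: contraNF ne21 => /eqP <-.
  rewrite !insideE lh1 lh2 /L' /recolor !eqxx orbT !opp_half_neq o12 o21 /=.
  by rewrite lh1 lh2 swapb.
set x := L (opp_half h1) in xS0 fS'; set y := L (opp_half h2) in yS0 fS'.
have key S : 1 <= excess L' S ->
    [/\ excess L' S <= 1, b \notin S & a |: S0 :\ b \subset S].
  move=> S1; have IS0 : b \notin S -> excess L (S :&: S0) <= 0.
    by move=> bS; apply: (core_notin cS0 bS0); rewrite inE (negPf bS).
  have aU : a \in S -> excess L (S :|: S0) <= 0.
    by move=> aS; apply: free_a; rewrite inE aS.
  have cupS := @excess_cup _ _ X L S S0; have fS := fS' S.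
  have bS : b \notin S.
    apply/negP => bS; have [aS|aS] := boolP (a \in S).
      by move: (free_a aS) fS S1; rewrite bS aS; clear; lia.
    have /sub /subsetP sS : 1 <= excess L S.
      by move: fS S1; rewrite bS (negPf aS); clear; lia.
    by move: fS S1 (le1 S); rewrite bS (negPf aS) !sS //; clear; lia.
  have aS : a \in S.
    apply/negPn/negP => aS; have /sub /subsetP sS : 1 <= excess L S.
      by move: fS S1; rewrite (negPf bS) (negPf aS); clear; lia.
    by rewrite sS in bS.
  have U0 := aU aS; have I0 := IS0 bS; rewrite (negPf bS) aS /= in fS.
  split=> //; first by move: cupS U0 I0 f1 fS; clear; lia.
  have [xS yS] : x \in S /\ y \in S.
    move: cupS U0 I0 f1 fS S1; clear.
    by case: (x \in S); case: (y \in S); rewrite /=; split => //; lia.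
  have fI : excess L (S :&: S0) = 0.
    by move: cupS U0 I0 f1 fS S1; rewrite xS yS; clear; lia.
  have bI : b \notin S :&: S0 by rewrite inE (negPf bS).
  have n12 : h1 != h2 by rewrite eq_sym.
  have := excess_add2 pL bI n12 hX1 hX2 lh1 lh2.
  rewrite -/x -/y !inE xS yS xS0 yS0 fI => f2.
  have /sub /subsetP sI : 1 <= excess L (b |: S :&: S0) by move: f2; clear; lia.
  apply/subsetP => z; rewrite in_setU1 => /orP[/eqP -> //|].
  rewrite in_setD1 => /andP[zb /sI]; rewrite !inE (negPf zb) /= => /andP[] //.
(* No edge at the free label [a] ends in the core, so adding [a] only costs one label. *)
have fa D : D \subset S0 -> excess L (a |: D) = excess L D - 1.
  move=> sD; have aD : a \notin D by apply: contra aS0; apply/subsetP.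
  rewrite excess_setU1 // (_ : star L a _ = set0) ?cards0 ?addr0 //.
  apply/setP => g; rewrite [RHS]inE; apply/negP => /starP[gX lg _].
  rewrite in_setU1 -{1}lg (negPf (proper_opp pL gX)) /= => /(subsetP sD).
  by apply/negP/(free_edge pL free_a) => //; rewrite f1.
split.
- have S0'1 : 1 <= excess L' (a |: S0 :\ b).
    have := fS' (a |: S0 :\ b); rewrite fa ?subsetDl // fb.
    have xb : x != b by rewrite -lh1; exact: proper_opp pL hX1.
    have yb : y != b by rewrite -lh2; exact: proper_opp pL hX2.
    by rewrite !inE !eqxx xS0 yS0 xb yb (negPf nab) /= !orbT; clear; lia.
  split=> [|S|S /key[] //].
    by have [] := key _ S0'1; move: S0'1; clear; lia.
  have [/key[] //|] : 1 <= excess L' S \/ excess L' S <= 0.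
    by move: (excess L' S) => z; clear; lia.
  by move: (excess L' S) => z; clear; lia.
- move=> S bS; have [/key[_]|//] : 1 <= excess L' S \/ excess L' S <= 0.
    by move: (excess L' S) => z; clear; lia.
  by rewrite bS.
- move=> z zS0 zb; pose D := S0 :\ b :\ z.
  have za : z != a by apply: contraNneq aS0 => <-.
  have sD : D \subset S0 by apply: subset_trans (subsetDl _ _) (subsetDl _ _).
  have -> : (a |: S0 :\ b) :\ z = a |: D.
    apply/setP => t; rewrite !inE; case: (t =P z) => [->|] //=.
    by rewrite (negPf za).
  have -> : S0 :\ z = b |: D.
    apply/setP => t; rewrite !inE; case: (t =P b) => [->|] /=; last by [].
    by rewrite eq_sym zb bS0.
  have bD : b \notin D by rewrite !inE eqxx andbF.
  have n12 : h1 != h2 by rewrite eq_sym.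
  have := excess_add2 pL bD n12 hX1 hX2 lh1 lh2; rewrite -/x -/y.
  have := fS' (a |: D); rewrite fa // !in_setU1 eqxx (negPf nab) (negPf bD) /=.
  have xa : x != a by apply: contraNneq aS0 => <-.
  have ya : y != a by apply: contraNneq aS0 => <-.
  by rewrite (negPf xa) (negPf ya) /=; clear; lia.
Qed.

End Pairs.

(** * Reducing the excess by Kempe changes *)

Section Strategy.

Variables (E C : finType) (X : {set E}) (neg : C -> C).
Variable P : (E * bool -> C) -> Prop.
Implicit Types (L : E * bool -> C) (S T D A B : {set C}) (e : E) (g h : E * bool).

Hypothesis negK : involutive neg.
Hypothesis neg_neq : forall c, neg c != c.
Hypothesis card_X : (#|X| <= #|C|)%N.
Hypothesis P_proper : forall L, P L -> proper_labels X L.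
(** [pi] leads to the other end of the chain. One involution serves all [h], so distinct half-edges
    have distinct partners. *)
Hypothesis kempe : forall L a b, P L -> a != b ->
  exists2 pi : E * bool -> E * bool, involutive pi &
    forall h, h.1 \in X -> (pi h).1 \in X /\ P (recolor neg a b L h (pi h)).
(** The negated goal: every labelling that Kempe changes can reach has an overfull set. *)
Hypothesis stuck : forall L, P L -> exists S, 1 <= excess X L S.

Local Notation excess := (excess X).
Local Notation star := (star X).
Local Notation core := (core X).
Local Notation harmful := (harmful X neg).

Definition free L a := forall S, a \in S -> excess L S <= 0.

(** Overfull sets are closed under union, so a largest one contains all others; it is not the set of
    all colours, whose excess is [#|X| - #|C|]. *)
Lemma ex_free L S0 : core L S0 -> exists a, free L a.
Proof.
move=> [f1 le1 _]; have S01 : 1 <= excess L S0 by rewrite f1.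
case: (arg_maxnP (fun S : {set C} => #|S|) (P := fun S => 1 <= excess L S) S01).
move=> S S1 Smax; have [/existsP[a aS]|/existsPn all_in] := boolP [exists a, a \notin S].
  exists a => T aT; rewrite leNgt; apply/negP => T1.
  have := @excess_cup _ _ X L S T; have := le1 (S :&: T) => f2 f3.
  have /Smax cU : 1 <= excess L (S :|: T) by move: f2 f3 S1 T1; clear; lia.
  have /eqP ST : S == S :|: T by rewrite eqEcard subsetUl.
  by rewrite ST inE aT orbT in aS.
have ST : S = setT by apply/setP => x; rewrite inE; have := all_in x; rewrite negbK.
move: S1; rewrite ST excessE cardsT (eq_bigr (fun=> 1%N)); last first.
  by move=> e _; rewrite /inside !inE.
by rewrite sum1_card; move: card_X; clear; lia.
Qed.

Lemma kempe_step L S0 a b : P L -> core L S0 -> free L a -> b \in S0 ->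
  exists2 pi : E * bool -> E * bool, involutive pi &
  forall h, h \in star L b S0 -> (pi h).1 \in X /\
  ([/\ excess L (S0 :\ b) = 0, pi h \in star L b S0, pi h != h &
      P (recolor neg a b L h (pi h))] \/
   [/\ b != neg a, L (pi h) = neg a \/ L (pi h) = neg b &
      harmful L S0 a b h (pi h)]).
Proof.
move=> PL cS0 fa bS0; have [f1 _ _] := cS0.
have ab : a != b.
  by apply: contraTneq bS0 => <-; apply: (free_notin fa); rewrite f1.
have [pi piK piP] := kempe PL ab; exists pi => // h hb.
have [hX _ _ _] := starP hb; have [gX PL'] := piP h hX; split=> //.
have [[*]|] := recolor_step negK (P_proper PL) cS0 fa hb gX (stuck PL'); first by left.
by right.
Qed.

Lemma star_neq0 L S0 b : P L -> core L S0 -> b \in S0 -> exists h, h \in star L b S0.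
Proof.
move=> PL cS0 bS0; apply/set0Pn; rewrite -cards_eq0.
have := card_star_core (P_proper PL) cS0 bS0.
have : excess L (S0 :\ b) <= 0 by apply: (core_notin cS0 bS0); rewrite !inE eqxx.
by move: (#|star L b S0|) => n; clear; lia.
Qed.

(** The change of [a] and [neg a] involves a single pair, so no partner is harmful, and at a label
    of degree three or more the partner cannot be the only other half-edge. *)
Lemma free_branching L S0 a : P L -> core L S0 -> free L a -> neg a \in S0 ->
  excess L (S0 :\ neg a) < 0 -> False.
Proof.
move=> PL cS0 fa naS0 fna; have [pi _ piP] := kempe_step PL cS0 fa naS0.
have [h hs] := star_neq0 PL cS0 naS0.
have [_ [[f0 _ _ _]|[/eqP]]] := piP h hs; last by [].
by rewrite f0 in fna.
Qed.

(* The partners of the two edge-ends at [b] have different labels, since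
   otherwise [b] would be a cut vertex of degree two. *)
Lemma degree2_step L S0 a b : P L -> core L S0 -> free L a -> b \in S0 ->
  excess L (S0 :\ b) = 0 -> neg b \in S0 -> excess L (S0 :\ neg b) < 0 ->
  forall c, c = neg a \/ c = neg b ->
  exists h g, [/\ h \in star L b S0, L g = c & harmful L S0 a b h g].
Proof.
move=> PL cS0 fa bS0 fb nbS0 fnb; have pL := P_proper PL; have [f1 le1 sub] := cS0.
have [pi piK piP] := kempe_step PL cS0 fa bS0.
have bad h : h \in star L b S0 -> [/\ b != neg a, (pi h).1 \in X,
    L (pi h) = neg a \/ L (pi h) = neg b & harmful L S0 a b h (pi h)].
  move=> hs; have [gX [[_ gs gh PL']|[*]]] := piP h hs; last by split.
  (* If both half-edges moved from [b] to [a], then [b] would be free for the new core, in which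
     [neg b] still branches. *)
  exfalso; have [cL' fb' le'] := replace_core neg pL cS0 fa hs gs gh fb.
  have nbb := neg_neq b; apply: (free_branching PL' cL' fb').
    by rewrite !inE nbS0 nbb orbT.
  by apply: le_lt_trans (le' _ nbS0 nbb) fnb.
have cs : #|star L b S0| = 2%N.
  by have := card_star_core pL cS0 bS0; rewrite fb; move: #|_| => n; clear; lia.
have /cards2P[h1 [h2 [n12 sE]]] : #|star L b S0| == 2%N by rewrite cs.
have hs1 : h1 \in star L b S0 by rewrite sE set21.
have hs2 : h2 \in star L b S0 by rewrite sE set22.
have [bna gX1 l1 hm1] := bad _ hs1; have [_ gX2 l2 hm2] := bad _ hs2.
have npi : pi h1 != pi h2 by rewrite (can_eq piK).
have neq : L (pi h1) <> L (pi h2).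
  move=> l12; have ncb : L (pi h1) != b.
    by case: l1 => ->; rewrite ?neg_neq // eq_sym.
  have [_ _ _ _ [B [sB fB bB _ [o1 o2]]]] :=
    two_harmful pL cS0 fa hs1 hs2 npi gX1 gX2 erefl (esym l12) ncb hm1 hm2.
  have := card_star pL bB; rewrite fB.
  have -> : star L b B = set0.
    apply/setP => h; rewrite [RHS]inE; apply/negP => hB.
    have := subsetP (star_sub L b sB) _ hB; have [_ _ _ oB] := starP hB.
    by rewrite sE => /set2P[hE|hE]; move: oB; rewrite hE ?(negPf o1) ?(negPf o2).
  rewrite cards0; have : excess L (B :\ b) <= 0.
    by apply: (core_notin cS0 bS0); rewrite !inE eqxx.
  by clear; lia.
move=> c cE; have [l1c|l1c] := eqVneq (L (pi h1)) c; first by exists h1, (pi h1).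
exists h2, (pi h2); split=> //.
by case: l1 l2 cE neq l1c => -> [] -> [] -> // neq /eqP.
Qed.

(** In graph terms, [b] lies on every cycle of the core, like a branch vertex of a theta graph. *)
Definition central L S0 b :=
  forall D : {set C}, D \subset S0 -> D != set0 -> 0 <= excess L D -> b \in D.

Lemma tight_remove L A b : proper_labels X L -> b \in A -> excess L A = 0 ->
  (A :\ b != set0 -> excess L (A :\ b) < 0) -> (1 < #|star L b A|)%N.
Proof.
move=> pL bA fA lt; have [A0|/lt fAb] := eqVneq (A :\ b) set0; last first.
  by have := card_star pL bA; rewrite fA; move: (#|_|) fAb => n; clear; lia.
have := excess1 b pL; rewrite (_ : [set b] = A) ?fA //.
by rewrite -(setD1K bA) A0 setU0.
Qed.

(** At least three half-edges meet at [b], so two partners share the label [neg a] or [neg b]. If it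
    is [neg a], that label has degree two and is used up, and the tight set of [two_harmful]
    supplies two more half-edges at [b], whose partners must be labelled [neg b]. In either case
    [neg b] has degree two in the core, and [degree2_step] at [neg b] yields a tight set avoiding
    [b]. *)
Lemma no_central L S0 b : P L -> core L S0 -> b \in S0 -> central L S0 b -> False.
Proof.
move=> PL cS0 bS0 cen; have pL := P_proper PL; have [f1 le1 sub] := cS0.
have [a fa] := ex_free cS0; have [pi piK piP] := kempe_step PL cS0 fa bS0.
have fb : excess L (S0 :\ b) < 0.
  have [b0|n0] := eqVneq (S0 :\ b) set0.
    by have := excess1 b pL; rewrite (_ : [set b] = S0) ?f1 // -(setD1K bS0) b0 setU0.
  rewrite ltNge; apply/negP => /(cen _ (subsetDl _ _) n0).
  by rewrite !inE eqxx.
have bad h : h \in star L b S0 -> [/\ b != neg a, (pi h).1 \in X,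
    L (pi h) = neg a \/ L (pi h) = neg b & harmful L S0 a b h (pi h)].
  by move=> hs; have [gX [[f0 _ _ _]|[*]]] := piP h hs; [rewrite f0 in fb|split].
have pair h1 h2 : h1 \in star L b S0 -> h2 \in star L b S0 -> h1 != h2 ->
    L (pi h1) = L (pi h2) ->
    [/\ L (pi h1) \in S0, excess L (S0 :\ L (pi h1)) = 0,
      pi h1 \in star L (L (pi h1)) S0, pi h2 \in star L (L (pi h1)) S0 &
      exists h3 h4, [/\ h3 \in star L b S0, h4 \in star L b S0, h3 != h4 &
        [/\ h3 != h1, h3 != h2, h4 != h1 & h4 != h2]]].
  move=> hs1 hs2 n12 l12; have [bna gX1 l1 hm1] := bad _ hs1.
  have [_ gX2 _ hm2] := bad _ hs2.
  have ncb : L (pi h1) != b by case: l1 => ->; rewrite ?neg_neq // eq_sym.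
  have npi : pi h1 != pi h2 by rewrite (can_eq piK).
  have [cS fc gs1 gs2 [B [sB fB bB _ [o1 o2]]]] :=
    two_harmful pL cS0 fa hs1 hs2 npi gX1 gX2 erefl (esym l12) ncb hm1 hm2.
  split=> //; have /card_gt1P[h3 [h4 [hB3 hB4 n34]]] : (1 < #|star L b B|)%N.
    apply: (tight_remove pL bB fB) => n0; rewrite ltNge; apply/negP.
    have sBb : B :\ b \subset S0 by apply: subset_trans sB; apply: subsetDl.
    by move=> /(cen _ sBb n0); rewrite !inE eqxx.
  have sBS := subsetP (star_sub L b sB).
  have notB h h' : h \in star L b B -> L (opp_half h') \notin B -> h != h'.
    by move=> /starP[_ _ _ oB]; apply: contraNneq => <-.
  by exists h3, h4; split; rewrite ?sBS //; split; apply: notB.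
have [h [h' [hs hs' nh ln]]] : exists h h', [/\ h \in star L b S0,
    h' \in star L b S0, h != h' & L (pi h) = neg b /\ L (pi h') = neg b].
  have /card_gt2P[h1 [h2 [h3 [[s1 s2 s3] [n12 n23 n31]]]]] : (2 < #|star L b S0|)%N.
    have := card_star_core pL cS0 bS0; move: (#|_|) => n; move: fb; clear; lia.
  have [h [h' [s s' nhh' lE]]] : exists h h', [/\ h \in star L b S0,
      h' \in star L b S0, h != h' & L (pi h) = L (pi h')].
    have [_ _ l1 _] := bad _ s1; have [_ _ l2 _] := bad _ s2; have [_ _ l3 _] := bad _ s3.
    have [l12|l12] := eqVneq (L (pi h1)) (L (pi h2)); first by exists h1, h2.
    have [l23|l23] := eqVneq (L (pi h2)) (L (pi h3)); first by exists h2, h3.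
    exists h3, h1; split=> //.
    by case: l1 l2 l3 l12 l23 => -> [] -> [] -> //; rewrite eqxx.
  have [_ _ [la|lb] _] := bad _ s; last by exists h, h'; rewrite -lE.
  have [cS fc gs1 gs2 [h4 [h5 [s4 s5 n45 [n41 n42 n51 n52]]]]] := pair _ _ s s' nhh' lE.
  have other g : g \in star L b S0 -> g != h -> g != h' -> L (pi g) = neg b.
    move=> sg ngh ngh'; have [_ _ [lga|//] _] := bad _ sg; exfalso.
    have hg : h != g by rewrite eq_sym.
    have [_ _ _ gs _] := pair _ _ s sg hg (etrans la (esym lga)).
    have := card_star_core pL cS0 cS; rewrite fc => c2.
    have : (2 < #|star L (L (pi h)) S0|)%N.
      apply/card_gt2P; exists (pi h), (pi h'), (pi g); split=> //.
      by rewrite !(can_eq piK) nhh' ngh eq_sym ngh'.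
    by move: c2; move: #|_| => n; clear; lia.
  by exists h4, h5; split=> //; split; apply: other.
have [lh lh'] := ln; have := pair _ _ hs hs' nh (etrans lh (esym lh')).
rewrite lh => -[nbS fnb _ _ _]; have := degree2_step PL cS0 fa nbS fnb.
rewrite negK => /(_ bS0 fb b (or_intror erefl)) [k [g [_ lg [_ [S]]]]].
rewrite lg => -[bS _ yS _ /(_ bS0) [yS0 fI _]].
have : b \in S :&: S0.
  apply: cen; rewrite ?subsetIr ?fI //.
  by apply/set0Pn; exists (L (opp_half g)); rewrite inE yS.
by rewrite inE (negPf bS).
Qed.

(* In the multigraph of labels, a lobe is one of the two cycles of a core that
   consists of two disjoint cycles joined by a path, and [b] is the vertex of
   the cycle at which the path is attached. *)
Definition lobe L S0 b A := [/\ A \subset S0, excess L A = 0, b \in A,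
  excess L (S0 :\ b) = -1 &
  forall D : {set C}, D \subset A -> D != set0 -> D != A -> excess L D < 0].

Lemma lobe_star L S0 b A x : proper_labels X L -> lobe L S0 b A -> x \in A ->
  (1 < #|star L x A|)%N.
Proof.
move=> pL [_ fA _ _ minA] xA; apply: (tight_remove pL xA fA) => n0.
apply: minA; rewrite ?subsetDl //.
by apply: contraTneq xA => <-; rewrite !inE eqxx.
Qed.

(** By minimality of the lobe, [D :&: A] has negative excess, so supermodularity makes [D :|: A]
    overfull. *)
Lemma lobe_cup L S0 b A D : core L S0 -> lobe L S0 b A -> D :&: A != set0 ->
  ~~ (A \subset D) -> 0 <= excess L D -> S0 \subset D :|: A.
Proof.
move=> [f1 le1 sub] [_ fA _ _ minA] n0 nAD fD; apply: sub.
have : excess L (D :&: A) < 0.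
  by apply: minA; rewrite ?subsetIr //; apply: contra nAD => /eqP <-; apply: subsetIl.
by have := @excess_cup _ _ X L D A; rewrite fA; move: fD; clear; lia.
Qed.

(** Two of the three partners at [b] share a label [c], and [two_harmful] gives a tight set [B] that
    [h] and [h'] leave. If [c] is not in [A], then [B :|: A] misses [c], which forces [A \subset B];
    but then [b] has two half-edges in [A] besides [h] and [h'], four in all. *)
Lemma lobe_neg L S0 a b A : P L -> core L S0 -> free L a -> lobe L S0 b A ->
  exists c, [/\ c = neg a \/ c = neg b, c \in A & excess L (S0 :\ c) = 0].
Proof.
move=> PL cS0 fa lA; have pL := P_proper PL; have [f1 le1 sub] := cS0.
have [sA fA bA fb minA] := lA; have bS0 := subsetP sA _ bA.
have [pi piK piP] := kempe_step PL cS0 fa bS0.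
have bad h : h \in star L b S0 -> [/\ b != neg a, (pi h).1 \in X,
    L (pi h) = neg a \/ L (pi h) = neg b & harmful L S0 a b h (pi h)].
  by move=> hs; have [gX [[f0 _ _ _]|[*]]] := piP h hs; [rewrite f0 in fb|split].
have cs : #|star L b S0| = 3%N.
  by have := card_star_core pL cS0 bS0; rewrite fb; move: #|_| => n; clear; lia.
have /card_gt2P[h1 [h2 [h3 [[s1 s2 s3] [n12 n23 n31]]]]] : (2 < #|star L b S0|)%N.
  by rewrite cs.
have [h [h' [s s' nhh' lE]]] : exists h h', [/\ h \in star L b S0,
    h' \in star L b S0, h != h' & L (pi h) = L (pi h')].
  have [_ _ l1 _] := bad _ s1; have [_ _ l2 _] := bad _ s2; have [_ _ l3 _] := bad _ s3.
  have [l12|l12] := eqVneq (L (pi h1)) (L (pi h2)); first by exists h1, h2.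
  have [l23|l23] := eqVneq (L (pi h2)) (L (pi h3)); first by exists h2, h3.
  exists h3, h1; split=> //.
  by case: l1 l2 l3 l12 l23 => -> [] -> [] -> //; rewrite eqxx.
have [bna gX1 l1 hm1] := bad _ s; have [_ gX2 _ hm2] := bad _ s'.
have ncb : L (pi h) != b by case: l1 => ->; rewrite ?neg_neq // eq_sym.
have npi : pi h != pi h' by rewrite (can_eq piK).
have [cS fc _ _ [B [sB fB bB cB [o1 o2]]]] :=
  two_harmful pL cS0 fa s s' npi gX1 gX2 erefl (esym lE) ncb hm1 hm2.
exists (L (pi h)); split=> //; apply/negPn/negP => cA.
have nAB : ~~ (A \subset B).
  apply/negP => sAB; have := lobe_star pL lA bA; rewrite leqNgt => /negP; apply.
  have : (#|star L b A :|: [set h; h']| <= 3)%N.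
    rewrite -cs; apply/subset_leq_card/subsetP => g; rewrite in_setU.
    by move=> /orP[/(subsetP (star_sub L b sA))//|/set2P[->|->]].
  have dis : star L b A :&: [set h; h'] = set0.
    apply/setP => g; rewrite [RHS]inE in_setI; apply/andP => -[/starP[_ _ _ oA]].
    have := subsetP sAB _ oA.
    by move=> oB /set2P[gE|gE]; move: oB; rewrite gE ?(negPf o1) ?(negPf o2).
  have := cardsUI (star L b A) [set h; h']; rewrite dis cards0 cards2 nhh'.
  by move: #|_| => n; move: #|_| => m; clear; lia.
have nI : B :&: A != set0 by apply/set0Pn; exists b; rewrite inE bB.
have := lobe_cup cS0 lA nI nAB; rewrite fB lexx => /(_ isT) /subsetP /(_ _ cS).
by rewrite inE (negPf cA) (negPf cB).
Qed.

(* [- excess L (S0 :\ x)] is the degree of [x] in the core minus two. *)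
Lemma sum_branching L S0 D : proper_labels X L -> core L S0 -> D \subset S0 ->
  \sum_(x in D) - excess L (S0 :\ x) = 1 + excess L D - excess L (S0 :\: D).
Proof.
move=> pL [f1 _ _] sD; have := sum_star sD pL; rewrite f1.
under eq_bigr => x _ do rewrite addrAC addrC.
by rewrite big_split /= sumr_const; move: (\sum_(_ in _) _) => z; clear; lia.
Qed.

Lemma branching_ge0 L S0 x : core L S0 -> x \in S0 -> 0 <= - excess L (S0 :\ x).
Proof.
by move=> cS0 xS0; rewrite oppr_ge0; apply: (core_notin cS0 xS0); rewrite !inE eqxx.
Qed.

Lemma core_setD L S0 D : core L S0 -> D \subset S0 -> D != set0 ->
  excess L (S0 :\: D) <= 0.
Proof.
move=> cS0 sD /set0Pn[x xD]; apply: (core_notin cS0 (subsetP sD _ xD)).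
by rewrite inE xD.
Qed.

(** The branchings in [D] sum to one, so [D] has a single branch vertex, of degree three. Over a
    tight subset they sum to at least one, so a smallest such subset contains it. *)
Lemma ex_lobe L S0 D : proper_labels X L -> core L S0 -> D \subset S0 ->
  D != set0 -> excess L D = 0 -> excess L (S0 :\: D) = 0 ->
  exists b A, [/\ A \subset D, lobe L S0 b A &
    forall x, x \in D -> x != b -> excess L (S0 :\ x) = 0].
Proof.
move=> pL cS0 sD nD fD fD'; have [f1 le1 sub] := cS0.
pose tight (A : {set C}) := [&& A \subset D, A != set0 & excess L A == 0].
have tD : tight D by rewrite /tight subxx nD fD eqxx.
have [A /and3P[sA nA /eqP fA] minA] := arg_minnP (fun A : {set C} => #|A|) tD.
have nS D1 : D1 \subset D -> ~~ (S0 \subset D1).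
  move=> sD1; apply: contra (nD) => /subset_trans /(_ sD1) sS.
  have /eqP DS : D == S0 by rewrite eqEsubset sD.
  by move: fD; rewrite DS f1.
have sAS := subset_trans sA sD.
have w0 x : x \in D -> 0 <= - excess L (S0 :\ x).
  by move=> xD; apply: (branching_ge0 cS0); apply: (subsetP sD).
have sumD := sum_branching pL cS0 sD; rewrite fD fD' subr0 addr0 in sumD.
have [b bA wb] : exists2 b, b \in A & 0 < - excess L (S0 :\ b).
  have [/existsP[b /andP[bA wb]]|/existsPn no] :=
    boolP [exists b, (b \in A) && (0 < - excess L (S0 :\ b))]; first by exists b.
  have := sum_branching pL cS0 sAS; rewrite big1 => [|x xA].
    by move: (core_setD cS0 sAS nA); rewrite fA; clear; lia.
  have := no x; rewrite xA /= -leNgt => le; apply/eqP; rewrite eq_le le.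
  by apply: w0; apply: (subsetP sA).
have bD := subsetP sA _ bA.
have sumb : \sum_(x in D | x != b) - excess L (S0 :\ x) = 1 + excess L (S0 :\ b).
  by have := sumD; rewrite (bigD1 b) //= => <-; rewrite addrAC addNr add0r.
have ge0 : 0 <= \sum_(x in D | x != b) - excess L (S0 :\ x).
  by apply: sumr_ge0 => x /andP[/w0].
exists b, A; split=> //.
  split=> //; first by move: ge0 sumb wb; clear; lia.
  move=> D1 s1 n1 nA1; have sD1 := subset_trans s1 sA.
  rewrite lt_neqAle (core_proper cS0) ?nS // andbT.
  apply: contra nA1 => f0; rewrite eqEcard s1.
  by apply: minA; rewrite /tight sD1 n1.
move=> x xD xb; have s0 : \sum_(x in D | x != b) - excess L (S0 :\ x) = 0.
  by move: ge0 sumb wb; clear; lia.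
have := psumr_eq0P _ s0 => /(_ _ x); rewrite xD xb => /(_ _ isT) H.
apply/eqP; rewrite -oppr_eq0; apply/eqP/H => y /andP[/w0] //.
Qed.

(** A harmful partner labelled [neg a] comes with a tight set that contains [b] but not [neg a]. It
    does not contain the lobe, since the edge of [h] at [neg b] lies in the lobe but not in it; then
    [lobe_cup] puts [neg a] into one of the two. *)
Lemma lobe_neg_free L S0 a b A : P L -> core L S0 -> free L a -> lobe L S0 b A ->
  neg b \in A -> excess L (S0 :\ neg b) = 0 -> neg a \in S0 -> neg a \notin A ->
  False.
Proof.
move=> PL cS0 fa lA nbA fnb naS0 naA; have pL := P_proper PL.
have [sA fA bA fb minA] := lA; have [bS0 nbS0] := (subsetP sA _ bA, subsetP sA _ nbA).
have fb0 : excess L (S0 :\ b) < 0 by rewrite fb.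
have := degree2_step PL cS0 fa nbS0 fnb; rewrite negK.
move=> /(_ bS0 fb0 (neg a) (or_introl erefl)) [h [g [hs lg [_ [S]]]]].
rewrite lg => -[naS swS yS _ /(_ naS0)[yS0 fI hI]].
have bS : b \in S.
  move: swS; rewrite /swap negK eqxx (negPf (neg_neq a)).
  by case: eqP => [nanb|//]; rewrite -nanb (negPf naA) in nbA.
have sstar : star L (neg b) A = star L (neg b) S0.
  apply/eqP; rewrite eqEcard star_sub //=.
  have := lobe_star pL lA nbA; have := card_star_core pL cS0 nbS0; rewrite fnb.
  by move: #|_| => n; move: #|_| => m; clear; lia.
have [hX lh _ oh] := starP hs; have : h \in star L (neg b) A by rewrite sstar.
move=> /starP[_ _ _ ohA].
have nA : ~~ (A \subset S :&: S0).
  apply: contra hI => /subsetP sAI.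
  by rewrite insideE lh !sAI.
have nI : S :&: S0 :&: A != set0.
  by apply/set0Pn; exists b; rewrite !inE bS bS0.
have := lobe_cup cS0 lA nI nA; rewrite fI lexx => /(_ isT) /subsetP /(_ _ naS0).
by rewrite !inE (negPf naA) (negPf naS).
Qed.

(** If [D] met [A'], then [D :|: A'] would be the core. As [D] has total branching at most one,
    [S0 :\: D] has nonnegative excess; being a nonempty part of [A'], it is [A'] itself. *)
Lemma tight_disjoint L S0 b b' A A' D : proper_labels X L -> core L S0 ->
  lobe L S0 b A -> lobe L S0 b' A' ->
  (forall x, x \in S0 -> x != b -> x != b' -> excess L (S0 :\ x) = 0) ->
  D \subset S0 -> b' \notin D -> 0 <= excess L D -> D :&: A' = set0.
Proof.
move=> pL cS0 [_ _ _ fb _] lA' rest sD bD fD; apply/eqP/negPn/negP => nI.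
have [sA' _ bA' _ minA'] := lA'; have b'S0 := subsetP sA' _ bA'.
have nA : ~~ (A' \subset D) by apply: contra bD => /subsetP; apply.
have sU := lobe_cup cS0 lA' nI nA fD.
have fD0 := core_notin cS0 b'S0 bD.
have sum1 : \sum_(x in D) - excess L (S0 :\ x) <= 1.
  have others x : x \in D -> x != b -> - excess L (S0 :\ x) = 0.
    move=> xD xb; rewrite rest ?oppr0 ?(subsetP sD) //.
    by apply: contraNneq bD => <-.
  have [bD'|bD'] := boolP (b \in D).
    by rewrite (bigD1 b) //= fb big1 ?opprK ?addr0 // => x /andP[]; apply: others.
  by rewrite big1 // => x xD; apply: others => //; apply: contraNneq bD' => <-.
have sA : S0 :\: D \subset A' by rewrite subDset.
have nD : S0 :\: D != set0 by apply/set0Pn; exists b'; rewrite inE bD.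
have fDc : 0 <= excess L (S0 :\: D).
  by move: sum1; rewrite (sum_branching pL cS0 sD); move: fD fD0; clear; lia.
have /eqP DA : S0 :\: D == A'.
  by apply/negPn/negP => nE; move: (minA' _ sA nD nE) fDc; clear; lia.
case/set0Pn: nI => x; rewrite -DA !inE => /andP[xD]; by rewrite xD.
Qed.

(** The degree sum forces a branch vertex into [D], and only [b] is available; [lobe_cup] does the
    rest. *)
Lemma tight_contains L S0 b b' A A' D : proper_labels X L -> core L S0 ->
  lobe L S0 b A -> lobe L S0 b' A' -> A :&: A' = set0 ->
  (forall x, x \in S0 -> x != b -> x != b' -> excess L (S0 :\ x) = 0) ->
  D \subset S0 -> D != set0 -> b' \notin D -> 0 <= excess L D -> A \subset D.
Proof.
move=> pL cS0 lA [sA' _ bA' _ _] dis rest sD nD bD fD.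
have [_ _ bA _ _] := lA; have b'S0 := subsetP sA' _ bA'.
have bD' : b \in D.
  apply/negPn/negP => bD'; have := sum_branching pL cS0 sD.
  have := core_setD cS0 sD nD; rewrite big1 => [|x xD].
    by move: fD; clear; lia.
  by rewrite rest ?oppr0 ?(subsetP sD) //; [move: bD'|move: bD];
    apply: contraNneq => <-.
apply/negPn/negP => nA; have nI : D :&: A != set0.
  by apply/set0Pn; exists b; rewrite inE bD'.
have := lobe_cup cS0 lA nI nA fD => /subsetP /(_ _ b'S0).
rewrite inE (negPf bD) /= => bA2.
by have := in_set0 b'; rewrite -dis inE bA2 bA'.
Qed.

(* Moving one end of an edge of the first lobe from [b1] to [b2] joins the two
   lobes, whatever the Kempe change does elsewhere: afterwards [b2] is central. *)
Lemma two_lobes_neg L S0 b1 b2 A1 A2 : P L -> core L S0 ->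
  lobe L S0 b1 A1 -> lobe L S0 b2 A2 -> A1 :&: A2 = set0 ->
  (forall x, x \in S0 -> x != b1 -> x != b2 -> excess L (S0 :\ x) = 0) ->
  neg b1 \in A1 -> neg b2 \in A2 -> False.
Proof.
move=> PL cS0 lA1 lA2 dis rest nbA1 nbA2; have pL := P_proper PL.
have [f1 le1 sub] := cS0.
have [sA1 fA1 bA1 fb1 min1] := lA1; have [sA2 fA2 bA2 fb2 min2] := lA2.
have dis12 x : x \in A1 -> x \in A2 -> False.
  by move=> x1 x2; have := in_set0 x; rewrite -dis inE x1 x2.
have neqA x y : x \in A1 -> y \in A2 -> x != y.
  by move=> xA yA; apply/eqP => xy; apply: (dis12 x) => //; rewrite xy.
have n21 : b2 != b1 by rewrite eq_sym neqA.
have [b1S b2S] := (subsetP sA1 _ bA1, subsetP sA2 _ bA2).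
have [nb1S nb2S] := (subsetP sA1 _ nbA1, subsetP sA2 _ nbA2).
have rest' x : x \in S0 -> x != b2 -> x != b1 -> excess L (S0 :\ x) = 0.
  by move=> xS x2 x1; apply: rest.
have t1 D : D \subset S0 -> b1 \notin D -> 0 <= excess L D -> D :&: A1 = set0.
  exact: tight_disjoint pL cS0 lA2 lA1 rest'.
have t2 D : D \subset S0 -> b2 \notin D -> 0 <= excess L D -> D :&: A2 = set0.
  exact: tight_disjoint pL cS0 lA1 lA2 rest.
have t3 D : D \subset S0 -> D != set0 -> b2 \notin D -> 0 <= excess L D -> A1 \subset D.
  exact: tight_contains pL cS0 lA1 lA2 dis rest.
have star2 b A x : lobe L S0 b A -> x \in A -> excess L (S0 :\ x) = 0 ->
    star L x A = star L x S0.
  move=> lA xA fx; have [sA _ _ _ _] := lA; apply/eqP; rewrite eqEcard star_sub //=.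
  have := lobe_star pL lA xA; have := card_star_core pL cS0 (subsetP sA _ xA).
  by rewrite fx; move: #|_| => n; move: #|_| => m; clear; lia.
have snb1 := star2 _ _ _ lA1 nbA1 (rest _ nb1S (neg_neq _) (neqA _ _ nbA1 bA2)).
have nb21 : neg b2 != b1 by rewrite eq_sym neqA.
have snb2 := star2 _ _ _ lA2 nbA2 (rest _ nb2S nb21 (neg_neq _)).
have [pi piK piP] := kempe PL n21.
(* Two half-edges at [b1] run inside [A1], while at most one of the three at [b2] leaves [A2]; so
   one of the two is not paired with it. *)
have [h hA hK] : exists2 h, h \in star L b1 A1 &
    pi h \notin star L b2 S0 :\: star L b2 A2.
  have /card_gt1P[h1 [h2 [s1 s2 n12]]] := lobe_star pL lA1 bA1.
  have [k1|k1] := boolP (pi h1 \in star L b2 S0 :\: star L b2 A2); last by exists h1.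
  exists h2 => //; apply/negP => k2.
  have : (1 < #|star L b2 S0 :\: star L b2 A2|)%N.
    by apply/card_gt1P; exists (pi h1), (pi h2); split; rewrite ?(can_eq piK).
  have := cardsD (star L b2 S0) (star L b2 A2).
  rewrite (setIidPr (star_sub L b2 sA2)) => ->.
  have := lobe_star pL lA2 bA2; have := card_star_core pL cS0 b2S; rewrite fb2.
  by move: #|_| => n; move: #|_| => m; clear; lia.
have [hX lh _ xA1] := starP hA; have [gX PL'] := piP h hX.
move: (pi h) => g in hK gX PL' *; set x1 := L (opp_half h) in xA1.
set L' := recolor _ _ _ _ _ _ in PL'.
have x1b : x1 != b1 by rewrite -lh; apply: proper_opp pL hX.
have swap1 : swap neg b2 b1 b1 = b2 by rewrite /swap eq_sym (negPf n21) eqxx.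
have swap2 : swap neg b2 b1 b2 = b1 by rewrite /swap eqxx.
have swap3 : swap neg b2 b1 (neg b1) = neg b2.
  rewrite /swap (negPf (neqA _ _ nbA1 bA2)) (negPf (neg_neq _)) eqxx.
  by rewrite (negPf (neqA _ _ nbA1 nbA2)).
have swap4 : swap neg b2 b1 (neg b2) = neg b1.
  by rewrite /swap (negPf (neg_neq _)) (negPf nb21) eqxx.
have swapV c : [\/ c = b1, c = b2, c = neg b1 | c = neg b2] \/ swap neg b2 b1 c = c.
  rewrite /swap; case: eqP => [->|_]; first by left; constructor 2.
  case: eqP => [->|_]; first by left; constructor 1.
  case: eqP => [->|_]; first by left; constructor 4.
  by case: eqP => [->|_]; [left; constructor 3|right].
(* All four exchanged labels lie in the core, so no label enters or leaves a superset of it. *)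
have big_eq T : S0 \subset T -> excess L' T = excess L T.
  move=> /subsetP sT; rewrite !excessE; congr (_%:Z - _); apply: eq_bigr => e _.
  have L'T k : (L' k \in T) = (L k \in T).
    rewrite /L' /recolor; case: ifP => // _; have [[] ->|->//] := swapV (L k).
    - by rewrite swap1 !sT.
    - by rewrite swap2 !sT.
    - by rewrite swap3 !sT.
    - by rewrite swap4 !sT.
  by rewrite /inside !L'T.
have L'h : L' h = b2 by rewrite /L' /recolor eqxx /= lh.
have L'off k : k.1 != h.1 -> k.1 != g.1 -> L' k = L k.
  rewrite /L' /recolor; case: (k =P h) => [->|_]; first by rewrite eqxx.
  by case: (k =P g) => [->|//]; rewrite eqxx.
have edit D : excess L' D + (inside L D h.1)%:Z <= excess L D + (inside L' D h.1)%:Z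
      /\ g.1 = h.1 \/
    [/\ g.1 != h.1, inside L' D h.1 = (b2 \in D) && (x1 \in D),
      inside L' D g.1 = (swap neg b2 b1 (L g) \in D) && (L (opp_half g) \in D) &
      excess L' D + (inside L D h.1)%:Z + (inside L D g.1)%:Z =
      excess L D + (inside L' D h.1)%:Z + (inside L' D g.1)%:Z].
  have [eg|ng] := eqVneq g.1 h.1; [left|right].
    by split=> //; rewrite (excess_edit1 D hX) // => k nk; apply: L'off; rewrite ?eg.
  have ohg : (opp_half h == g) = false by apply: contraNF ng => /eqP <-.
  split=> //; last exact: excess_edit2.
    by rewrite insideE L'h /L' /recolor opp_half_neq ohg.
  rewrite insideE /L' /recolor eqxx orbT opp_half_neq orbF.
  by case: eqP => // ogh; rewrite -ogh eqxx in ng.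
have hin D : inside L D h.1 = (b1 \in D) && (x1 \in D) by rewrite insideE lh.
(* A tight [D] without [b2] contains [A1] and thus loses the edge of [h]. Only the edge of [g] can
   make up for a loss. *)
have small D : D \subset S0 -> D != set0 -> b2 \notin D -> excess L' D < 0.
  move=> sD nD b2D; have fD0 := core_notin cS0 b2S b2D.
  have base : excess L D < 0 \/ [/\ excess L D = 0, b1 \in D, x1 \in D & D :&: A2 = set0].
    have [fD|fD] := ltrP (excess L D) 0; [by left|right].
    have sAD := t3 D sD nD b2D fD; split; rewrite ?(subsetP sAD) //; last exact: t2.
    by move: fD fD0; clear; lia.
  have in'h : inside L' D h.1 = false by rewrite insideE L'h (negPf b2D).
  have easy : excess L' D + (inside L D h.1)%:Z <= excess L D -> excess L' D < 0.
    rewrite hin; case: base => [lt|[f0 bD xD _]]; first by move: lt; clear; lia.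
    by rewrite f0 bD xD; clear; lia.
  have [[ed _]|[ng _ in'g ed]] := edit D.
    by apply: easy; rewrite in'h addr0 in ed.
  have [gin|gin] := boolP (inside L' D g.1); last first.
    by apply: easy; move: ed; rewrite in'h (negPf gin); clear; lia.
  have [gin'|gin'] := boolP (inside L D g.1).
    by apply: easy; move: ed; rewrite in'h gin gin'; clear; lia.
  have /andP[swD yD] : (swap neg b2 b1 (L g) \in D) && (L (opp_half g) \in D) by rewrite -in'g.
  have lgD : L g \notin D by move: gin'; rewrite insideE yD andbT.
  have yS := subsetP sD _ yD.
  (* If the edge of [g] enters [D], then [D] meets both lobes; for [L g = b2] this is where the
     choice of [h] counts. *)
  have [z zA [zD [z' zA' zD']]] : exists2 z, z \in A1 & z \in D /\
      exists2 z', z' \in A2 & z' \in D.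
    have [[] lg|sw] := swapV (L g); last by rewrite sw (negPf lgD) in swD.
    - by rewrite lg swap1 (negPf b2D) in swD.
    - exists b1 => //; split; first by rewrite lg swap2 in swD.
      exists (L (opp_half g)) => //.
      have : g \in star L b2 A2; last by case/starP.
      by move: hK; rewrite in_setD negb_and negbK => /orP[//|/negP[]]; apply/starP.
    - have : g \in star L (neg b1) A1 by rewrite snb1; apply/starP.
      case/starP => _ _ _ yA; exists (L (opp_half g)) => //; split=> //.
      by exists (neg b2) => //; rewrite -swap3 -lg.
    - have : g \in star L (neg b2) A2 by rewrite snb2; apply/starP.
      case/starP => _ _ _ yA; exists (neg b1) => //; split; first by rewrite lg swap4 in swD.
      by exists (L (opp_half g)).
  have ltD : excess L D < 0.
    by case: base => // -[_ _ _ D0]; have := in_set0 z'; rewrite -D0 inE zD' zA'.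
  have [sAD|nAD] := boolP (A1 \subset D).
    by move: ed ltD; rewrite in'h gin hin !(subsetP sAD) //; clear; lia.
  have lt2 : excess L D < -1.
    rewrite ltNge; apply/negP => geD.
    have nI : D :&: A1 != set0 by apply/set0Pn; exists z; rewrite inE zD.
    have : excess L (D :&: A1) < 0.
      by apply: min1; rewrite ?subsetIr //; apply: contra nAD => /eqP <-; apply: subsetIl.
    have := @excess_cup _ _ X L D A1; rewrite fA1 => cup lt.
    have sU : D :|: A1 \subset S0 by rewrite subUset sD.
    have b2U : b2 \notin D :|: A1.
      by rewrite inE (negPf b2D); apply/negP => /dis12 /(_ bA2).
    have fU : 0 <= excess L (D :|: A1) by move: cup lt geD; clear; lia.
    by have := in_set0 z'; rewrite -(t2 _ sU b2U fU) !inE zD' zA'.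
  by move: ed lt2; rewrite in'h gin; clear; lia.
have large D : D \subset S0 -> b2 \in D -> excess L' D <= 1.
  move=> sD b2D; have [/big_eq ->|nSD] := boolP (S0 \subset D); first exact: le1.
  have fD0 := core_proper cS0 nSD.
  have [[ed _]|[ng in'h _ ed]] := edit D.
    by move: ed fD0; clear; do 2!case: (inside _ _ _); lia.
  have [fD|fD] := ltrP (excess L D) 0.
    by move: ed fD; clear; do 4!case: (inside _ _ _); lia.
  have in'h0 : (inside L' D h.1)%:Z <= (inside L D h.1)%:Z.
    rewrite in'h hin b2D /=; have [bD|bD] := boolP (b1 \in D); first by [].
    have D0 := t1 D sD bD fD; case: (boolP (x1 \in D)) => // xD.
    by have := in_set0 x1; rewrite -D0 inE xD xA1.
  by move: ed in'h0 fD0; clear; do 4!case: (inside _ _ _); lia.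
have f1' : excess L' S0 = 1 by rewrite big_eq.
have leI D : D \subset S0 -> excess L' D <= 1.
  move=> sD; have [b2D|b2D] := boolP (b2 \in D); first exact: large.
  have [->|nD] := eqVneq D set0; first by rewrite excess0.
  by apply: le_trans (ltW (small D sD nD b2D)) _.
have le1' S : excess L' S <= 1.
  have := @excess_cup _ _ X L' S S0; have := leI _ (subsetIr S S0).
  rewrite [excess L' (S :|: S0)]big_eq ?subsetUr // f1'.
  by have := le1 (S :|: S0); clear; lia.
have [S0' cS0'] := ex_core le1' (stuck PL').
have [f1'' _ sub'] := cS0'; have sS : S0' \subset S0 by apply: sub'; rewrite f1'.
have nS0' : S0' != set0 by apply: contra_eq_neq f1'' => ->; rewrite excess0.
have b2S' : b2 \in S0'.
  by apply/negPn/negP => /(small _ sS nS0'); rewrite f1''.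
apply: (no_central PL' cS0' b2S') => D sD nD fD.
apply/negPn/negP => /(small _ (subset_trans sD sS) nD).
by move: fD; clear; lia.
Qed.

(** The branchings of the core sum to two. Unless the branch vertex [b] is central, some tight [D]
    avoids it, and the degree sum makes [S0 :\: D] tight as well; each side contains a lobe. The
    same free [a] serves both lobes, and they are disjoint, so [neg a] is in at most one of them and
    the other contains the negative of its branch vertex. *)
Lemma excess_reducible L : P L -> (forall S, excess L S <= 1) -> False.
Proof.
move=> PL le1; have pL := P_proper PL; have [S0 cS0] := ex_core le1 (stuck PL).
have [f1 _ sub] := cS0; have [a fa] := ex_free cS0.
have nS0 : S0 != set0 by apply: contra_eq_neq f1 => ->; rewrite excess0.
have [b [bS0 wb]] : exists b, b \in S0 /\ 0 < - excess L (S0 :\ b).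
  have [/existsP[b /andP[bS wb]]|/existsPn no] :=
    boolP [exists b, (b \in S0) && (0 < - excess L (S0 :\ b))]; first by exists b.
  have := sum_branching pL cS0 (subxx S0); rewrite setDv excess0 f1 big1 // => x xS.
  have := no x; rewrite xS /= -leNgt => le; apply/eqP; rewrite eq_le le.
  exact: branching_ge0 cS0 xS.
have [/existsP[D /and4P[sD nD fD bD]]|/existsPn cen] := boolP [exists D : {set C},
    [&& D \subset S0, D != set0, 0 <= excess L D & b \notin D]]; last first.
  apply: (no_central PL cS0 bS0) => D sD nD fD.
  by have := cen D; rewrite sD nD fD /= negbK.
have fD0 : excess L D = 0.
  by have := core_notin cS0 bS0 bD; move: fD; clear; lia.
have DE : S0 :\: (S0 :\: D) = D by rewrite setDDr setDv set0U (setIidPr sD).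
have sD' : S0 :\: D \subset S0 by apply: subsetDl.
have bD' : b \in S0 :\: D by rewrite inE bD.
have nD' : S0 :\: D != set0 by apply/set0Pn; exists b.
have fD' : excess L (S0 :\: D) = 0.
  have := core_setD cS0 sD nD; have := sum_branching pL cS0 sD'.
  rewrite DE fD0 (bigD1 b) //=.
  have : 0 <= \sum_(x in S0 :\: D | x != b) - excess L (S0 :\ x).
    by apply: sumr_ge0 => x /andP[/(subsetP sD')/(branching_ge0 cS0)].
  by move: wb; move: (\sum_(_ in _ | _) _) => z; clear; lia.
have [b1 [A1 [sA1 lA1 r1]]] := ex_lobe pL cS0 sD nD fD0 fD'.
have fDE : excess L (S0 :\: (S0 :\: D)) = 0 by rewrite DE.
have [b2 [A2 [sA2 lA2 r2]]] := ex_lobe pL cS0 sD' nD' fD' fDE.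
have dis12 x : x \in A1 -> x \in A2 -> False.
  by move=> /(subsetP sA1) xD /(subsetP sA2); rewrite inE xD.
have dis : A1 :&: A2 = set0.
  by apply/setP => x; rewrite !inE; apply/andP => -[/dis12].
have rest x : x \in S0 -> x != b1 -> x != b2 -> excess L (S0 :\ x) = 0.
  move=> xS x1 x2; have [xD|xD] := boolP (x \in D); first exact: r1.
  by apply: r2; rewrite ?inE ?xD.
have [c1 [e1 cA1 f01]] := lobe_neg PL cS0 fa lA1.
have [c2 [e2 cA2 f02]] := lobe_neg PL cS0 fa lA2.
have inS A x : A \subset S0 -> x \in A -> x \in S0 by move=> /subsetP; apply.
have [s1 _ _ _ _] := lA1; have [s2 _ _ _ _] := lA2.
case: e1 e2 => e1 [] e2; rewrite {}e1 {}e2 in cA1 cA2 f01 f02.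
- exact: dis12 cA1 cA2.
- apply: (lobe_neg_free PL cS0 fa lA2 cA2 f02); first exact: inS cA1.
  by apply/negP => /(dis12 _ cA1).
- apply: (lobe_neg_free PL cS0 fa lA1 cA1 f01); first exact: inS cA2.
  by apply/negP => /dis12 /(_ cA2).
- exact: two_lobes_neg PL cS0 lA1 lA2 dis rest cA1 cA2.
Qed.

End Strategy.

(** * Kempe chains *)

Section Dihedral.

Variables (T : finType) (i1 i2 : T -> T).
Hypotheses (i1K : involutive i1) (i2K : involutive i2).

(** Orbits of the group generated by two involutions; on slots these are the Kempe chains. *)
Definition dihedral : rel T := connect [rel x y | (y == i1 x) || (y == i2 x)].

Lemma dihedral1 x : dihedral x (i1 x).
Proof. by apply: connect1; rewrite /= eqxx. Qed.

Lemma dihedral2 x : dihedral x (i2 x).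
Proof. by apply: connect1; rewrite /= eqxx orbT. Qed.

Lemma dihedral_sym : symmetric dihedral.
Proof.
apply: sym_connect_sym => x y /=.
by rewrite -(can2_eq i1K i1K) -(can2_eq i2K i2K) ![_ == x]eq_sym.
Qed.

(* From a fixed point [p] of [i1] the orbit is that of [i2 \o i1], on which
   [i1] acts as a reflection fixing [p]. *)
Lemma dihedral_fixed p q q' : i1 p = p -> i1 q = q -> i1 q' = q' ->
  dihedral p q -> dihedral p q' -> q != p -> q' != p -> q = q'.
Proof.
pose f := i2 \o i1 => p1 q1 q'1.
have finj : injective f by apply: inj_comp; apply: can_inj.
have ref n x : iter n f (i1 (iter n f x)) = i1 x.
  elim: n x => //= n IH x; rewrite -iterS iterSr.
  by rewrite (_ : f (i1 (f (iter n f x))) = i1 (iter n f x)) // /f /= i1K i2K.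
have orb x : dihedral p x -> fconnect f p x.
  have cl y : fconnect f p y -> fconnect f p (i1 y).
    move=> /iter_findex <-; rewrite fconnect_sym //.
    by have := fconnect_iter f (findex f p y) (i1 (iter (findex f p y) f p)); rewrite ref p1.
  move=> /connectP[s]; elim/last_ind: s x => [|s z IH] x /=; first by move=> _ ->.
  rewrite rcons_path last_rcons => /andP[ps zE] ->.
  have {IH} := IH _ ps erefl; case/orP: zE => /eqP -> cy; first exact: cl.
  apply: connect_trans (cl _ cy) _.
  by rewrite -[i2 _](_ : f (i1 (last p s)) = _) ?fconnect1 // /f /= i1K.
(* The reflection [i1] inverts iterates of [f] at [p]. If it fixes [iter n f p], then [2 * n] is a
   multiple of the order, hence equal to it. *)
have half x : fconnect f p x -> i1 x = x -> x != p ->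
    (findex f p x + findex f p x = order f p)%N.
  move=> px x1 xp; set n := findex f p x; have fx : iter n f p = x by apply: iter_findex.
  have n0 : (0 < n)%N by rewrite lt0n; apply: contra xp => /eqP n0; rewrite -fx n0.
  have nm : (n < order f p)%N by apply: findex_max.
  have f2 : iter (n + n) f p = p by rewrite iterD fx -x1 -{1}fx ref.
  have [lt|ge] := ltnP (n + n) (order f p).
    by have := findex_iter lt; rewrite f2 findex0; move: n0; clear; lia.
  have lt : (n + n - order f p < order f p)%N by move: nm; clear; lia.
  have f3 : iter (n + n - order f p) f p = p.
    by apply: etrans f2; rewrite -[in RHS](subnK ge) iterD (iter_order finj).
  have := findex_iter lt; rewrite f3 findex0.
  by move: ge; clear; lia.
move=> /orb pq /orb pq' nq nq'; rewrite -(iter_findex pq) -(iter_findex pq').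
have := half _ pq q1 nq; have := half _ pq' q'1 nq' => <- eq2.
by congr iter; move: eq2; clear; lia.
Qed.

End Dihedral.

Section Swap.

Variables (C : finType) (neg : C -> C) (a b : C).
Hypothesis negK : involutive neg.
Hypothesis neg_neq : forall c, neg c != c.
Hypothesis ab : a != b.

Lemma swapK : involutive (swap neg a b).
Proof.
have /eqP nab := ab; have /eqP na := neg_neq a; have /eqP nb := neg_neq b.
have na2 := negK a; have nb2 := negK b.
move=> c; rewrite /swap; case: (c =P a) => [?|?]; last case: (c =P b) => [?|?];
  last case: (c =P neg a) => [?|?]; last case: (c =P neg b) => [?|?];
  repeat (match goal with |- context [if ?x == ?y then _ else _] => case: (x =P y) => ? end);
  congruence.
Qed.

Lemma swap_neg c : swap neg a b (neg c) = neg (swap neg a b c).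
Proof.
have /eqP nab := ab; have /eqP na := neg_neq a; have /eqP nb := neg_neq b.
have na2 := negK a; have nb2 := negK b; have nc2 := negK c.
rewrite /swap.
repeat (match goal with |- context [if ?x == ?y then _ else _] => case: (x =P y) => ? end);
  congruence.
Qed.

End Swap.

(** * Colourings by an even number of colours *)

Section Coloring.

Variables (G : multigraph) (C : finType) (neg : C -> C) (t : edge G -> bool).
Hypothesis negK : involutive neg.
Hypothesis neg_neq : forall c, neg c != c.

Implicit Types (e : edge G) (u v w x : vertex G) (c : C) (F : {set edge G}).
Implicit Types (gamma : edge G -> vertex G -> C).

(** The colour at one end of [e] in terms of that at the other; [t e] marks the positive edges. *)
Definition transfer e c := if t e then neg c else c.

Lemma transferK e : involutive (transfer e).
Proof. by rewrite /transfer; case: (t e) => c //; apply: negK. Qed.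

(** [gamma] is total, but only its values on edges of [F] at their own ends count. *)
Definition coloring F gamma :=
  (forall e u w, e \in F -> u \in ends e -> w \in ends e -> u != w ->
     gamma e w = transfer e (gamma e u)) /\
  (forall e e' u, e \in F -> e' \in F -> u \in ends e -> u \in ends e' ->
     gamma e u = gamma e' u -> e = e').

Definition far e u : vertex G := odflt u [pick w in ends e | w != u].

Lemma farP e u : u \in ends e ->
  [/\ far e u \in ends e, far e u != u & ends e = [set u; far e u]].
Proof.
move=> ue; have c2 := card_ends e; rewrite /far; case: pickP => [w /andP[we wu]|no] /=.
  split=> //; apply/esym/eqP; rewrite eqEcard c2 cards2 eq_sym wu andbT.
  by rewrite subUset !sub1set ue.
have : #|ends e :\ u| = 0%N by apply: eq_card0 => w; rewrite !inE andbC no.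
by have := cardsD1 u (ends e); rewrite ue c2 => + c0; rewrite c0.
Qed.

Lemma far_eq e u w : u \in ends e -> w \in ends e -> w != u -> w = far e u.
Proof.
by move=> ue; have [_ _ {1}->] := farP ue; rewrite in_set2 => /orP[/eqP ->|/eqP //]; rewrite eqxx.
Qed.

Lemma farK e u : u \in ends e -> far e (far e u) = u.
Proof. by move=> ue; have [fe nf _] := farP ue; apply/esym/far_eq; rewrite // eq_sym. Qed.

Definition free_slot F gamma (s : vertex G * C) :=
  forall e, e \in F -> s.1 \in ends e -> gamma e s.1 != s.2.

(** * Changing colours on a union of Kempe chains *)

Section KempeChange.

Variables (F : {set edge G}) (gamma : edge G -> vertex G -> C) (a b : C).
Hypothesis col : coloring F gamma.
Hypothesis ab : a != b.

Let sw := swap neg a b.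
Let swK : involutive sw := swapK negK neg_neq ab.

Lemma sw_transfer e c : sw (transfer e c) = transfer e (sw c).
Proof. by rewrite /transfer; case: (t e); rewrite // /sw swap_neg. Qed.

(* A slot is a vertex with a colour; it is either free or filled by a unique
   half-edge, and then [other_slot] is the slot of the other half. *)
Definition other_slot (s : vertex G * C) : vertex G * C :=
  if [pick e in F | (s.1 \in ends e) && (gamma e s.1 == s.2)] is Some e
  then (far e s.1, gamma e (far e s.1)) else s.

Definition swap_slot (s : vertex G * C) : vertex G * C := (s.1, sw s.2).

Lemma other_slotE e u : e \in F -> u \in ends e ->
  other_slot (u, gamma e u) = (far e u, gamma e (far e u)).
Proof.
move=> eF ue; rewrite /other_slot; case: pickP => [e' /and3P[/= e'F ue' /eqP g]|].
  by rewrite (col.2 _ _ _ e'F eF ue' ue g).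
by move=> /(_ e); rewrite eF ue eqxx.
Qed.

Lemma other_slot_free s : free_slot F gamma s -> other_slot s = s.
Proof.
move=> fs; rewrite /other_slot; case: pickP => // e /and3P[eF se].
by rewrite (negPf (fs e eF se)).
Qed.

Lemma other_slotK : involutive other_slot.
Proof.
move=> [u c]; have [/existsP[e /and3P[eF ue /eqP <-]]|/existsPn no] :=
    boolP [exists e, [&& e \in F, u \in ends e & gamma e u == c]].
  have [fe _ _] := farP ue.
  by rewrite other_slotE // other_slotE // farK.
by rewrite !other_slot_free // => e eF ue; have := no e; rewrite eF ue.
Qed.

Lemma swap_slotK : involutive swap_slot.
Proof. by case=> u c; rewrite /swap_slot /= swK. Qed.

Variable Z : pred (vertex G * C).
Hypothesis Z_other : forall s, Z (other_slot s) = Z s.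
Hypothesis Z_swap : forall s, Z (swap_slot s) = Z s.

Definition change u c := if Z (u, c) then sw c else c.

Lemma change_inj u : injective (change u).
Proof.
move=> c d; rewrite /change; case: ifP => Zc; case: ifP => Zd.
- exact: can_inj swK _ _.
- by move=> cd; move: Zd; rewrite -cd -[(u, _)]/(swap_slot (u, c)) Z_swap Zc.
- by move=> cd; move: Zc; rewrite cd -[(u, _)]/(swap_slot (u, d)) Z_swap Zd.
- by [].
Qed.

(** Closure of [Z] under [other_slot] makes both halves of an edge change together; closure under
    [swap_slot] keeps the colours at a vertex distinct. *)
Lemma coloring_change : coloring F (fun e u => change u (gamma e u)).
Proof.
split=> [e u w eF ue we uw|e e' u eF e'F ue ue' /change_inj]; last exact: col.2.
have wE : w = far e u by apply: far_eq; rewrite // eq_sym.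
have := Z_other (u, gamma e u); rewrite other_slotE // -wE /change => ->.
by rewrite (col.1 _ _ _ eF ue we uw); case: ifP => // _; rewrite sw_transfer.
Qed.

Lemma free_slot_change u c : free_slot F gamma (u, c) ->
  free_slot F (fun e w => change w (gamma e w)) (u, change u c).
Proof.
move=> fs e eF ue /=; apply: contra (fs e eF ue) => /eqP /change_inj -> //.
Qed.

End KempeChange.

(** * Private colours for the edges at a new vertex *)

Section Lists.

Variables (F : {set edge G}) (v : vertex G).

(* The label [L h] of a half-edge [h] of an edge [e] at [v] is a colour that
   [e] may take at [v]; it corresponds to a slot at the other end of [e]. *)
Definition slot (L : edge G * bool -> C) (h : edge G * bool) : vertex G * C :=
  (far h.1 v, transfer h.1 (L h)).

(** Slots are distinct, so parallel new edges have disjoint lists; edges to different vertices may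
    share labels, and the orientation resolves this. *)
Definition lists (X : {set edge G}) (L : edge G * bool -> C) := exists gamma,
  [/\ coloring F gamma,
      forall h, h.1 \in X -> free_slot F gamma (slot L h) &
      forall h h', h.1 \in X -> h'.1 \in X -> slot L h = slot L h' -> h = h'].

Lemma lists_proper X L : lists X L -> proper_labels X L.
Proof.
move=> [gamma [_ _ inj]] e eX; apply/eqP => L01.
by have := inj (e, false) (e, true) eX eX; rewrite /slot /= L01 => /(_ erefl).
Qed.

(** Slots of labels are free, that is, fixed by [other_slot], so the chain from one of them contains
    at most one other. If it contains none, [pi h] is [h]. *)
Lemma lists_kempe X L a b : lists X L -> a != b ->
  exists2 pi : edge G * bool -> edge G * bool, involutive pi &
    forall h, h.1 \in X -> (pi h).1 \in X /\ lists X (recolor neg a b L h (pi h)).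
Proof.
move=> [gamma [col fr inj]] ab.
pose i1 := other_slot F gamma; pose i2 := swap_slot a b.
have i1K : involutive i1 := other_slotK col.
have i2K : involutive i2 := swap_slotK ab.
pose Z s := dihedral i1 i2 s.
have Zsym s s' : Z s s' = Z s' s := dihedral_sym i1K i2K s s'.
have fix1 h : h.1 \in X -> i1 (slot L h) = slot L h.
  by move=> hX; apply/other_slot_free/fr.
have uniqZ h h' h'' : h.1 \in X -> h'.1 \in X -> h''.1 \in X ->
    Z (slot L h) (slot L h') -> Z (slot L h) (slot L h'') -> h' != h -> h'' != h ->
    h' = h''.
  move=> hX h'X h''X Zh' Zh'' n' n''; apply: (inj h' h'') => //.
  apply: (dihedral_fixed i1K i2K (fix1 h hX) (fix1 h' h'X) (fix1 h'' h''X) Zh' Zh'').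
    by apply: contraNneq n' => /(inj _ _ h'X hX) ->.
  by apply: contraNneq n'' => /(inj _ _ h''X hX) ->.
pose partner h h' := [&& h.1 \in X, h'.1 \in X, h' != h & Z (slot L h) (slot L h')].
have partner_sym h h' : partner h h' = partner h' h.
  by rewrite /partner Zsym andbCA [h == h']eq_sym.
pose pi h := odflt h (pick (partner h)).
have piE h h' : partner h h' -> pi h = h'.
  move=> hh'; rewrite /pi; case: pickP => [h'' /and4P[hX h''X n'' Z'']|/(_ h')] /=.
    by have /and4P[_ h'X n' Z'] := hh'; apply: (uniqZ h).
  by rewrite hh'.
have pi_not h : (forall h', ~~ partner h h') -> pi h = h.
  by rewrite /pi; case: pickP => // h' hh' /(_ h'); rewrite hh'.
have pi_cases h : partner h (pi h) \/ pi h = h.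
  have [/existsP[h' hh']|/existsPn no] := boolP [exists h', partner h h'].
    by left; rewrite (piE _ _ hh').
  by right; apply: pi_not.
exists pi => [h|h hX].
  have [hh'|hh] := pi_cases h; last by rewrite !hh.
  by rewrite (piE (pi h) h) // partner_sym.
split; first by have [/and4P[]|->] := pi_cases h.
have Z_closed i : (forall s, dihedral i1 i2 s (i s)) ->
    forall s, Z (slot L h) (i s) = Z (slot L h) s.
  move=> ci s; apply/idP/idP => Zs; last exact: connect_trans Zs (ci s).
  by apply: connect_trans Zs _; rewrite -/(dihedral _ _) [dihedral _ _ _ _]Zsym; apply: ci.
have Z1 := Z_closed _ (dihedral1 i1 i2); have Z2 := Z_closed _ (dihedral2 i1 i2).
have slotE h' : h'.1 \in X -> slot (recolor neg a b L h (pi h)) h' =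
    (far h'.1 v, change a b (Z (slot L h)) (far h'.1 v) (transfer h'.1 (L h'))).
  move=> h'X; rewrite /slot /change /recolor -/(slot L h').
  have -> : Z (slot L h) (slot L h') = (h' == h) || (h' == pi h).
    have [->|n'] := eqVneq h' h; first by rewrite /Z /dihedral connect0.
    apply/idP/eqP => [Z'|h'E].
      by apply/esym/piE; rewrite /partner hX h'X n' Z'.
    have [/and4P[_ _ _]|hh] := pi_cases h; first by rewrite -h'E.
    by rewrite h'E hh eqxx in n'.
  by case: ifP => // _; rewrite sw_transfer.
exists (fun e u => change a b (Z (slot L h)) u (gamma e u)); split.
- exact: coloring_change.
- move=> h' h'X; rewrite slotE //; apply: free_slot_change => //.
  exact: fr.
- move=> h1 h2 X1 X2; rewrite !slotE // => -[f12]; rewrite f12 => /change_inj c12.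
  by apply: inj => //; rewrite /slot f12 c12.
Qed.

End Lists.

(** At [u], each coloured edge blocks one colour and each listed edge parallel to [e] two; the
    hypothesis leaves two more for [e]. *)
Lemma lists_add F v (X : {set edge G}) L e : lists F v X L ->
  (forall S, excess X L S <= 0) -> e \notin X ->
  (#|[set e' in F | far e v \in ends e']| +
    (#|[set e' in X | far e' v == far e v]|.+1).*2 <= #|C|)%N ->
  exists L', lists F v (e |: X) L' /\ forall S, excess (e |: X) L' S <= 1.
Proof.
move=> [gamma [col fr inj]] le0 eX small; pose u := far e v.
pose used1 := [set gamma e' u | e' in [set e' in F | u \in ends e']].
pose used2 := [set (slot v L h).2 | h in
  setX [set e' in X | far e' v == u] [set: bool]].
have c1 := leq_imset_card (fun e' => gamma e' u) (mem [set e' in F | u \in ends e']).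
have c2 := leq_imset_card (fun h => (slot v L h).2)
  (mem (setX [set e' in X | far e' v == u] [set: bool])).
rewrite cardsX cardsT card_bool in c2.
have /card_gt1P[d1 [d2 [d1U d2U d12]]] : (1 < #|~: (used1 :|: used2)|)%N.
  have := cardsC (used1 :|: used2); have := cardsUI used1 used2.
  have : (#|used1| <= #|[set e' in F | u \in ends e']|)%N := c1.
  have : (#|used2| <= #|[set e' in X | far e' v == u]| * 2)%N := c2.
  move: small; rewrite -/u.
  move: #|_ :|: _| => n1; move: #|_ :&: _| => n2; move: #|~: _| => n3.
  move: #|used1| => n4; move: #|used2| => n5.
  by move: #|[set _ in F | _]| => n6; move: #|[set _ in X | _]| => n7; clear; lia.
pose d (i : bool) := if i then d1 else d2.
have dU i : d i \notin used1 :|: used2 by case: i; rewrite -in_setC.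
have d_inj : injective d by case=> -[] //= d12E; rewrite d12E eqxx in d12.
pose L' (h : edge G * bool) := if h.1 == e then transfer e (d h.2) else L h.
have slotX h : h.1 \in X -> slot v L' h = slot v L h.
  by move=> hX; rewrite /slot /L'; case: eqP hX => // ->; rewrite (negPf eX).
have slote i : slot v L' (e, i) = (u, d i) by rewrite /slot /L' /= eqxx transferK.
have new i h : h.1 \in X -> slot v L h <> (u, d i).
  move=> hX hE; have := dU i; rewrite in_setU negb_or => /andP[_ /negP]; apply.
  apply/imsetP; exists h; last by rewrite hE.
  by rewrite !inE hX; case: hE => -> _; rewrite eqxx.
exists L'; split.
  exists gamma; split=> // [[e' i] /= /setU1P[->|e'X]|[e1 i1] [e2 i2] /= X1 X2].
  - rewrite slote => e'' e''F ue'' /=; have := dU i.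
    rewrite in_setU negb_or => /andP[nu _]; apply: contraNneq nu => <-.
    by apply/imsetP; exists e''; rewrite ?inE ?e''F.
  - by rewrite slotX //; apply: fr.
  - case/setU1P: X1 => [->|X1]; case/setU1P: X2 => [->|X2].
    + by rewrite !slote => -[/d_inj ->].
    + by rewrite slote slotX // => /esym/new; case.
    + by rewrite slote slotX // => /new; case.
    + by rewrite !slotX // => /inj; apply.
move=> S; have := le0 S; rewrite !excessE big_setU1 //=.
have -> : (\sum_(e' in X) inside L' S e' = \sum_(e' in X) inside L S e')%N.
  apply: eq_bigr => e' e'X; have ne : e' != e by apply: contraNneq eX => <-.
  by rewrite /inside /L' /= (negPf ne).
by case: (inside L' S e); clear; lia.
Qed.

(** After each new edge the excess is brought back to 0, so it never exceeds 1. The colouring of [F]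
    may change on the way. *)
Lemma ex_lists F v (X : {set edge G}) gamma (c0 : C) : coloring F gamma ->
  (#|X| <= #|C|)%N ->
  (forall e, e \in X -> #|[set e' in F | far e v \in ends e']| +
    #|[set e' in X | far e' v == far e v]|.*2 <= #|C|)%N ->
  exists L, lists F v X L /\ forall S, excess X L S <= 0.
Proof.
move=> col leX small; move cX: #|X| => n; elim: n X cX leX small => [|n IH] X cX leX small.
  move/eqP: cX; rewrite cards_eq0 => /eqP ->; exists (fun=> c0); split.
    by exists gamma; split=> // h; rewrite inE.
  by move=> S; rewrite excessE big_set0; clear; lia.
have /set0Pn[e eX] : X != set0 by rewrite -cards_eq0 cX.
have cXe : #|X :\ e| = n by have := cardsD1 e X; rewrite eX cX => -[].
have sub : X :\ e \subset X := subsetDl _ _.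
have [|e' /(subsetP sub)/small|L [PL le0]] := IH _ cXe.
- by apply: leq_trans leX; apply: subset_leq_card.
- apply: leq_trans; rewrite leq_add2l leq_double; apply: subset_leq_card.
  by apply/subsetP => e2; rewrite !inE => /andP[/andP[_ ->] ->].
have eXe : e \notin X :\ e by rewrite !inE eqxx.
have [|L1 [PL1 le1]] := lists_add PL le0 eXe.
  apply: leq_trans (small e eX); rewrite leq_add2l leq_double.
  rewrite [X in (_ <= X)%N](cardsD1 e) inE eX eqxx ltnS; apply: subset_leq_card.
  by apply/subsetP => e2; rewrite !inE andbA.
rewrite (setD1K eX) in PL1 le1.
apply: boolp.contrapT => stuck.
apply: (@excess_reducible _ _ X neg (lists F v X) negK neg_neq _ _ _ _ L1) => //.
- exact: lists_proper.
- by move=> L2 a b; apply: lists_kempe.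
move=> L2 PL2; have [/existsP[S S1]|/existsPn no] := boolP [exists S, 1 <= excess X L2 S].
  by exists S.
case: stuck; exists L2; split=> // S.
by move: (no S); rewrite -ltNge; clear; lia.
Qed.

Lemma extend_coloring F v (X : {set edge G}) gamma : coloring F gamma ->
  (forall e, e \in F -> v \notin ends e) -> (forall e, e \in X -> v \in ends e) ->
  (#|X| <= #|C|)%N ->
  (forall e, e \in X -> #|[set e' in F | far e v \in ends e']| +
    #|[set e' in X | far e' v == far e v]|.*2 <= #|C|)%N ->
  exists gamma', coloring (F :|: X) gamma'.
Proof.
move=> col nF vX leX small; have [->|/set0Pn[e0 e0X]] := eqVneq X set0.
  by rewrite setU0; exists gamma.
have /card_gt0P[c0 _] : (0 < #|C|)%N.
  by apply: leq_trans leX; rewrite (cardD1 e0) e0X.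
have [L [[gamma1 [col1 fr inj]] le0]] := ex_lists c0 col leX small.
have [phi phi_inj] := excess_orientation le0.
have nX e : e \in F -> (e \in X) = false.
  by move=> eF; apply: contraNF (nF e eF) => /vX.
exists (fun e u => if e \in X then
  if u == v then L (e, phi e) else transfer e (L (e, phi e)) else gamma1 e u).
have clash e e' u : e \in F -> e' \in X -> u \in ends e -> u \in ends e' ->
    gamma1 e u = (if u == v then L (e', phi e') else transfer e' (L (e', phi e'))) ->
    e = e'.
  move=> eF e'X ue ue'; have nu : u != v by apply: contraTneq ue => ->; apply: nF.
  rewrite (negPf nu) => gE; have := fr (e', phi e') e'X e eF.
  by rewrite /slot /= -(far_eq (vX _ e'X) ue' nu) gE eqxx => /(_ ue).
split=> [e u w /setUP[eF|eX] ue we uw|e e' u /setUP[eF|eX] /setUP[e'F|e'X] ue ue'].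
- by rewrite nX //; apply: col1.1.
- rewrite eX; have ve := vX _ eX; have [_ nf eE] := farP ve.
  case: (u =P v) => [uv|/eqP nu].
    by rewrite -uv eq_sym (negPf uw).
  case: (w =P v) => [_|/eqP nw]; first by rewrite transferK.
  by move: uw; rewrite (far_eq ve ue nu) (far_eq ve we nw) eqxx.
- by rewrite !nX //; apply: col1.2.
- by rewrite nX // e'X; apply: clash.
- by rewrite eX nX // => gE; apply/esym/(clash e' e u).
- rewrite eX e'X; case: (u =P v) => [_|/eqP nu]; first exact: phi_inj.
  move=> gE; have := inj (e, phi e) (e', phi e') eX e'X.
  rewrite /slot /= -(far_eq (vX _ eX) ue nu) -(far_eq (vX _ e'X) ue' nu) gE.
  by move=> /(_ erefl) [].
Qed.

Definition degree_in F u := #|[set e in F | u \in ends e]|.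

Definition spanned F (W : {set vertex G}) := [set e in F | ends e \subset W].

(** The vertices of [A] come before all others. The far end [u] of an edge at the new vertex [v] is
    then in [A]: either [v] and all earlier vertices are, or [v] is not and the edge must meet [A]
    at [u]. *)
Lemma coloring_exists F (A : {set vertex G}) m (c0 : C) :
  (forall u w, u != w -> multiplicity u w <= m)%N ->
  (forall u, degree_in F u <= #|C|)%N ->
  (forall u, u \in A -> degree_in F u + m <= #|C|)%N ->
  (forall e, e \in F -> ~~ [disjoint ends e & A]) ->
  exists gamma, coloring F gamma.
Proof.
move=> le_m le_deg le_A meetA.
suff main n (W : {set vertex G}) : #|W| = n -> W \subset A \/ A \subset W ->
    exists gamma, coloring (spanned F W) gamma.
  have [|gamma] := main _ [set: vertex G] erefl; first by right; apply: subsetT.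
  by rewrite (_ : spanned F _ = F); [exists gamma|apply/setP => e; rewrite inE subsetT andbT].
elim: n W => [|n IH] W cW sW.
  exists (fun _ _ => c0); split=> [e u w|e e' u]; rewrite inE => /andP[_ /subsetP sub].
    move=> /sub uW; move/eqP: cW; rewrite cards_eq0 => /eqP W0.
    by rewrite W0 inE in uW.
  move=> _ /sub uW; move/eqP: cW; rewrite cards_eq0 => /eqP W0.
  by rewrite W0 inE in uW.
have [v vW [sWv Av]] : exists2 v, v \in W &
    (W :\ v \subset A \/ A \subset W :\ v) /\ (v \in A -> W \subset A).
  have [sWA|nWA] := boolP (W \subset A).
    have /set0Pn[v vW] : W != set0 by rewrite -cards_eq0 cW.
    exists v => //; split=> //; left; apply: subset_trans sWA; apply: subsetDl.
  have [v vW vA] := subsetPn nWA; exists v => //; split; last by rewrite (negPf vA).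
  by right; case: sW => [sWA|sAW]; [rewrite sWA in nWA|rewrite subsetD1 sAW].
have cWv : #|W :\ v| = n by have := cardsD1 v W; rewrite vW cW => -[].
have [gamma col] := IH _ cWv sWv.
pose X := [set e in spanned F W | v \in ends e].
have XF e : e \in X -> [/\ e \in F, v \in ends e & ends e \subset W].
  by rewrite !inE => /andP[/andP[]].
have [e|e /XF[]//|||gamma' col'] := @extend_coloring _ v X _ col.
- by rewrite !inE subsetD1 => /andP[_ /andP[]].
- apply: leq_trans (le_deg v); apply: subset_leq_card; apply/subsetP => e /XF[eF ve _].
  by rewrite inE eF.
- move=> e /XF[eF ve eW]; set u := far e v; have [ue nu eE] := farP ve; rewrite -/u in ue nu eE.
  have uA : u \in A.
    have uW := subsetP eW _ ue.
    have [/Av/subsetP/(_ _ uW)//|vA] := boolP (v \in A).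
    have := meetA e eF; rewrite -setI_eq0 => /set0Pn[x]; rewrite inE eE => /andP[/set2P[->|->//]].
    by rewrite (negPf vA).
  apply: leq_trans (le_A u uA).
  set Xu := [set e' in X | far e' v == u].
  have XuP e' : e' \in Xu -> e' \in X /\ ends e' = [set v; u].
    rewrite inE => /andP[e'X /eqP fe']; split=> //; have [_ ve' _] := XF _ e'X.
    by have [_ _] := farP ve'; rewrite fe'.
  have cXu : (#|Xu| <= m)%N.
    have vu : v != u by rewrite eq_sym.
    apply: leq_trans (le_m v u vu); apply: subset_leq_card; apply/subsetP => e' /XuP[_ e'E].
    by rewrite inE e'E.
  (* One copy of the edges parallel to [e] completes the degree of [u]; the other is bounded by
     [m]. *)
  rewrite -addnn addnA leq_add //.
  have -> : (#|[set e' in spanned F (W :\ v) | u \in ends e']| + #|Xu|)%N =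
      #|[set e' in spanned F (W :\ v) | u \in ends e'] :|: Xu|.
    rewrite cardsU (_ : _ :&: Xu = set0) ?cards0 ?subn0 //.
    apply/setP => e'; rewrite [RHS]inE in_setI; apply/andP => -[+ /XuP[_ e'E]].
    by rewrite !inE subsetD1 e'E set21 !andbF.
  apply: subset_leq_card; apply/subsetP => e' /setUP[|/XuP[/XF[e'F _ _] e'E]].
    by rewrite !inE => /andP[/andP[-> _] ->].
  by rewrite inE e'F e'E set22.
exists gamma'; move: col'; rewrite (_ : _ :|: X = spanned F W) //.
apply/setP => e; rewrite !inE subsetD1; case: (e \in F) => //=.
by case: (v \in ends e); rewrite ?andbF ?andbT ?orbF.
Qed.

End Coloring.

(** * Odd numbers of colours *)

Section Main.

Variable S : signed_multigraph.
Local Notation G := (graph S).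

Definition matching (M : {set edge G}) :=
  [forall e in M, forall e' in M, (e != e') ==> [disjoint ends e & ends e']].

Lemma matching_inj M e e' u : matching M -> e \in M -> e' \in M ->
  u \in ends e -> u \in ends e' -> e = e'.
Proof.
move=> mM eM e'M ue ue'; apply/eqP/negPn/negP => ne.
have := forall_inP (forall_inP mM e eM) e' e'M; rewrite ne /= -setI_eq0 => /eqP D.
by have := in_set0 u; rewrite -D inE ue ue'.
Qed.

Lemma degree_le (u : vertex G) : (degree u <= max_degree G)%N.
Proof. exact: leq_bigmax. Qed.

Lemma multiplicity_le (u w : vertex G) : u != w ->
  (multiplicity u w <= max_multiplicity G)%N.
Proof.
exact: (@leq_bigmax_cond _ (fun p => p.1 != p.2) (fun p => multiplicity p.1 p.2) (u, w)).
Qed.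

Lemma degree_in_le (F : {set edge G}) u : (degree_in F u <= max_degree G)%N.
Proof.
apply: leq_trans (degree_le u); apply: subset_leq_card; apply/subsetP => e.
by rewrite !inE => /andP[].
Qed.

(* For an odd number of colours, the colour 0 is given to a maximal matching;
   the vertices that it misses are then independent. *)
Lemma ex_matching (k := (max_degree G + max_multiplicity G)%N) :
  (0 < max_multiplicity G)%N ->
  exists (M : {set edge G}) (A : {set vertex G}),
  [/\ matching M, M != set0 -> odd k, forall u, (degree_in (~: M) u <= k./2.*2)%N,
    forall u, u \in A -> (degree_in (~: M) u + max_multiplicity G <= k./2.*2)%N &
    forall e, e \in ~: M -> ~~ [disjoint ends e & A]].
Proof.
move=> mu; have kE := odd_double_half k; have [ok|ek] := boolP (odd k); last first.
  have k2 : k = k./2.*2 by move: kE; rewrite (negPf ek).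
  exists set0, setT; split=> [||u|u _|e _].
  - by apply/forall_inP => e; rewrite inE.
  - by rewrite eqxx.
  - rewrite -k2; apply: leq_trans (degree_in_le _ u) _; exact: leq_addr.
  - by rewrite -k2 leq_add2r degree_in_le.
  - by rewrite -setI_eq0 setIT -cards_eq0 card_ends.
have m0 : matching set0 by apply/forall_inP => e; rewrite inE.
have [M maxM _] := maxset_exists m0; have mM := maxsetp maxM.
rewrite ok in kE; exists M, [set u | [exists e in M, u \in ends e]]; split=> // [u|u|e].
(* One colour is given up, but a positive multiplicity keeps the rest at least [max_degree G]. *)
- by have := degree_in_le (~: M) u; move: kE mu; rewrite /k; clear; lia.
- rewrite inE => /exists_inP[e eM ue].
  have : (degree_in (~: M) u < degree u)%N.
    apply: proper_card; apply/properP; split; last first.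
      by exists e; rewrite !inE ?ue ?eM.
    by apply/subsetP => e'; rewrite !inE => /andP[].
  by have := degree_le u; move: kE mu; rewrite /k; clear; lia.
rewrite inE => eM; apply/negP => dis.
have dis' e' : e' \in M -> [disjoint ends e & ends e'].
  move=> e'M; apply: disjointWr dis; apply/subsetP => x xe'.
  by rewrite inE; apply/exists_inP; exists e'.
have meM : matching (e |: M).
  apply/forall_inP => e1 /setU1P[->|e1M]; apply/forall_inP => e2 /setU1P[->|e2M];
    apply/implyP => ne; rewrite ?eqxx // in ne *.
  - exact: dis'.
  - by rewrite disjoint_sym dis'.
  - by have := forall_inP (forall_inP mM e1 e1M) e2 e2M; rewrite ne.
have := maxsetsup maxM meM (subsetUr _ _) => ME.
by rewrite -ME setU11 in eM.
Qed.

Section Palette.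

Variable r : nat.

Definition color : finType := ('I_r * bool)%type.

Definition color_neg (c : color) : color := (c.1, ~~ c.2).

(** The shift by one leaves 0 to the matching. *)
Definition color_int (c : color) : int :=
  if c.2 then - (c.1.+1)%:Z else (c.1.+1)%:Z.

Lemma color_negK : involutive color_neg.
Proof. by case=> i s; rewrite /color_neg negbK. Qed.

Lemma color_neg_neq c : color_neg c != c.
Proof. by case: c => i []; apply/eqP => -[]. Qed.

Lemma card_color : #|color| = r.*2.
Proof. by rewrite card_prod card_ord card_bool muln2. Qed.

Lemma color_int_inj : injective color_int.
Proof.
case=> [i s] [j s']; rewrite /color_int /=.
have [eqs|] := eqVneq s s'; last by case: s; case: s' => // _; clear; lia.
have [ij|nij] := eqVneq (i : nat) (j : nat); first by move/val_inj: ij => ->; rewrite eqs.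
by rewrite eqs; case: s' {eqs} => /= ijE; exfalso; move: nij ijE; clear; lia.
Qed.

Lemma color_int_neg c : color_int (color_neg c) = - color_int c.
Proof. by case: c => i []; rewrite /color_int /= ?opprK. Qed.

Lemma color_int_abs c : (`|color_int c| <= r)%N /\ color_int c != 0.
Proof. by case: c => [[i lt] []]; rewrite /color_int /=; split => //; lia. Qed.

End Palette.

Lemma edge_colorable_Vizing : edge_colorable S (max_degree G + max_multiplicity G).
Proof.
set k := (_ + _)%N.
(* An edge makes degree and multiplicity positive, so [k] is at least 2 and a default colour [c0]
   exists. *)
have [/existsP[e0 _]|/existsPn no] := boolP [exists e : edge G, true]; last first.
  by exists (fun=> 0); split=> [h|v h|h]; have := no (edge_of h).
have [u0 u0e] : exists u, u \in ends e0.
  by apply/set0Pn; rewrite -cards_eq0 card_ends.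
have [_ nu e0E] := farP u0e.
have mu : (0 < max_multiplicity G)%N.
  rewrite eq_sym in nu; apply: leq_trans (multiplicity_le nu).
  by apply/card_gt0P; exists e0; rewrite inE e0E.
have Delta : (0 < max_degree G)%N.
  by apply: leq_trans (degree_le u0); apply/card_gt0P; exists e0; rewrite inE.
have [M [A [mM oM deg degA meetA]]] := ex_matching mu.
rewrite -/k in oM deg degA.
have r0 : (0 < k./2)%N by rewrite /k; move: mu Delta; clear; lia.
pose t e := signature (s := S) e == 1.
rewrite -card_color in deg degA.
have c0 : color k./2 := (Ordinal r0, false).
have [gamma [col1 col2]] := coloring_exists t (@color_negK k./2)
  (@color_neg_neq k./2) c0 multiplicity_le deg degA meetA.
have transferE e c : color_int (transfer (@color_neg k./2) t e c) =
    - signature e * color_int c.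
  rewrite /transfer /t; case: (signatureP e) => ->.
    by rewrite eqxx mulN1r color_int_neg.
  by rewrite opprK mul1r.
have notM e : (e \in ~: M) = (e \notin M) by rewrite inE.
have ends_h (h : half_edge G) : end_of h \in ends (edge_of h) := valP h.
exists (fun h => if edge_of h \in M then 0 else color_int (gamma (edge_of h) (end_of h))).
split=> [h|v h h'|h h' eE nE].
- rewrite inE; case: ifP => hM.
    by rewrite oM //; apply/set0Pn; exists (edge_of h).
  have [le n0] := color_int_abs (gamma (edge_of h) (end_of h)).
  by rewrite le n0 orbT.
- rewrite !inE => /eqP hv /eqP hv'; have := ends_h h; have := ends_h h'.
  rewrite hv hv' => ve' ve gE.
  suff eE : edge_of h = edge_of h'.
    apply: val_inj; rewrite [val h]surjective_pairing [val h']surjective_pairing.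
    by congr pair; [exact: eE|rewrite -/(end_of h) hv -hv'].
  have [hM|hM] := boolP (edge_of h \in M); have [hM'|hM'] := boolP (edge_of h' \in M).
  + exact: matching_inj mM hM hM' ve ve'.
  + move: gE; rewrite hM (negPf hM') => gE.
    by have [_] := color_int_abs (gamma (edge_of h') v); rewrite -gE eqxx.
  + move: gE; rewrite hM' (negPf hM) => gE.
    by have [_] := color_int_abs (gamma (edge_of h) v); rewrite gE eqxx.
  + move: gE; rewrite (negPf hM) (negPf hM') => /color_int_inj gE.
    by apply: (col2 _ _ v) => //; rewrite notM.
- rewrite -eE; case: ifP => hM; first by rewrite mulr0.
  rewrite -transferE; congr color_int; apply: col1.
  + by rewrite notM hM.
  + by rewrite eE.
  + exact: ends_h.
  + by apply/eqP => ee; apply: nE.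
Qed.

End Main.

Theorem theorem1p2 (S : signed_multigraph) :
  (chromatic_index S <= max_degree (graph S) + max_multiplicity (graph S))%N.
Proof.
rewrite /chromatic_index; case: ex_minnP => n _; apply.
exact/boolp.asboolP/edge_colorable_Vizing.
Qed.
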